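(* Let $(\mathbb{X},\mathcal{X},\mu)$ be a probability space, let $\lambda\in[2,\infty)$, and let $(\tilde M,\tilde G,\tilde\phi)$ and $(M,G,\phi)$ be the manifolds of finite measures and of probability measures defined in the context. Then: (i) $\phi$ is a bijection from $M$ onto $G$. (ii) $(M,G,\phi)$ is a $C^{\lceil\lambda\rceil-1}$-embedded submanifold of $(\tilde M,\tilde G,\tilde\phi)$. (iii) Let $\rho:=\tilde\phi\circ\phi^{-1}:G\to\tilde G$ be the inclusion map $\imath:M\to\tilde M$ expressed in terms of the charts $\tilde\phi$ and $\phi$. For any bounded set $B\subset G$, $$\sup_{a\in B}\left(\|\rho(a)\|+\|D\rho_a\|+\cdots+\|D^{\lceil\lambda\rceil-1}\rho_a\|\right)<\infty .$$
   Context: $\mathbf{E}_\mu$ denotes expectation with respect to $\mu$. $\tilde M$ is the set of finite measures $P$ on $\mathcal{X}$ that are mutually absolutely continuous with respect to $\mu$ and whose density $p=dP/d\mu$ satisfies $\mathbf{E}_\mu p^\lambda<\infty$ and $\mathbf{E}_\mu|\log p|^\lambda<\infty$. $\tilde G=L^\lambda(\mu)$ (with its usual norm), and $\tilde\phi:\tilde M\to\tilde G$, $\tilde\phi(P)=p-1+\log p$, is a bijection, which is used as a single global chart making $\tilde M$ a Banach manifold modelled on $\tilde G$. $M=\{P\in\tilde M:\mathbf{E}_\mu p=1\}$ is the subset of probability measures in $\tilde M$. $G=L^\lambda_0(\mu)=\{a\in L^\lambda(\mu):\mathbf{E}_\mu a=0\}$ (with the norm of $L^\lambda(\mu)$), and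 $\phi:M\to G$ is defined by $$\phi(P)=\tilde\phi(P)-\mathbf{E}_\mu\tilde\phi(P)=p-1+\log p-\mathbf{E}_\mu\log p .$$ $M$ is given the Banach manifold structure modelled on $G$ with the single global chart $\phi$. $\lceil y\rceil:=\min\{i\in\mathbb{Z}:y\le i\}$. $D^i\rho_a$ denotes the $i$-th Fréchet derivative of $\rho$ at $a$, an element of the space of continuous $i$-linear maps $G^i\to\tilde G$ with the operator norm. ''$C^n$-embedded submanifold'' means that the inclusion map $\imath:M\to\tilde M$ is both a topological embedding (homeomorphism onto its image) and a $C^n$-immersion; the latter means that, in charts, $\rho=\tilde\phi\circ\phi^{-1}$ is of class $C^n$ and, for every $a\in G$, $D\rho_a:G\to\tilde G$ is injective and its image is a closed subspace of $\tilde G$ admitting a closed complementary subspace (it splits). *)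

(* Defs.v *)
From HB Require Import structures.
From mathcomp Require Import all_boot all_order all_algebra.
From mathcomp Require Import all_classical all_reals all_analysis.
From mathcomp Require Import measurable_realfun ess_sup_inf.

Set Implicit Arguments.
Unset Strict Implicit.
Unset Printing Implicit Defensive.

Import Order.TTheory GRing.Theory Num.Theory.
Import numFieldNormedType.Exports.

Local Open Scope classical_set_scope.
Local Open Scope ring_scope.

Lemma continuous_lincomb {R : realType} (X : topologicalType)
    (W : normedModType R) (c : R) (f g : X -> W) :
  continuous f -> continuous g -> continuous (fun x => c *: f x + g x).
Proof.
move=> fc gc x; apply: cvgD; last exact: gc.
exact: cvgZl_tmp (fc x).
Qed.

Lemma cvg_ptws (I : Type) (V : topologicalType)
    (F : set_system {ptws I -> V}) (l : {ptws I -> V}) : Filter F ->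
  (forall i U, nbhs (l i) U -> F [set h | U (h i)]) -> F --> l.
Proof.
move=> FF Fl; apply/cvg_sup => i A [B [[U oU <-] Ul UA]].
have /Fl : nbhs (l i) U by exact: open_nbhs_nbhs.
exact: filterS.
Qed.

Section multilinear.
Context {R : realType}.
Variables (V W : normedModType R) (n : nat).

(* The argument space V^n carries the product topology. *)
Definition continuous_multilinear (f : {ptws 'I_n -> V} -> W) : Prop :=
  (forall (h : 'I_n -> V) (k : 'I_n) (c : R) (u v : V),
     f (dfwith h k (c *: u + v)) =
     c *: f (dfwith h k u) + f (dfwith h k v)) /\
  continuous f.

Definition cmultilin_pred : {pred {ptws 'I_n -> V} -> W} :=
  [pred f | `[< continuous_multilinear f >]].

Record cmultilin := CMultilin {
  cmultilin_fun :> {ptws 'I_n -> V} -> W ;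
  _ : cmultilin_fun \in cmultilin_pred }.

HB.instance Definition _ := [isSub for cmultilin_fun].
HB.instance Definition _ := [Choice of cmultilin by <:].

Lemma cmultilin_predP f :
  reflect (continuous_multilinear f) (f \in cmultilin_pred).
Proof. exact: asboolP. Qed.

Lemma cmultilinP (f : cmultilin) : continuous_multilinear f.
Proof. by apply/cmultilin_predP; case: f. Qed.

Lemma cmultilin_submod_closed : submod_closed cmultilin_pred.
Proof.
split=> [|c f g].
  apply/cmultilin_predP; split.
    by move=> h k c u v; rewrite -[RHS]/(c *: (0 : W) + 0) scaler0 addr0.
  exact: (@cst_continuous _ _ (0 : W)).
move=> /cmultilin_predP[fl fc] /cmultilin_predP[gl gc].
apply/cmultilin_predP; split.
  move=> h k e u v.
  rewrite -[LHS]/(c *: f _ + g _) -[RHS]/(e *: (c *: f _ + g _) + (c *: f _ + g _)).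
  by rewrite fl gl !scalerDr !scalerA addrACA (mulrC c).
exact: continuous_lincomb.
Qed.

HB.instance Definition _ :=
  GRing.isSubmodClosed.Build _ _ cmultilin_pred cmultilin_submod_closed.
HB.instance Definition _ := [SubChoice_isSubLmodule of cmultilin by <:].


Lemma cmultilin_sectionZ (f : cmultilin) h k c u :
  f (dfwith h k (c *: u)) = c *: f (dfwith h k u).
Proof.
have [fl _] := cmultilinP f.
have f0 : f (dfwith h k 0) = 0.
  have /eqP := fl h k 1 0 0; rewrite scaler0 addr0 scale1r.
  by rewrite -[X in X == _]addr0 (inj_eq (addrI _)) => /eqP <-.
by have := fl h k c u 0; rewrite addr0 f0 addr0.
Qed.

Lemma cmultilin_homog (f : cmultilin) (c : 'I_n -> R) (h : 'I_n -> V) :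
  f (fun j => c j *: h j) = (\prod_j c j) *: f h.
Proof.
have H (s : seq 'I_n) : uniq s ->
    f (fun j => if j \in s then c j *: h j else h j) = (\prod_(j <- s) c j) *: f h.
  elim: s => [_|k s ih /= /andP[ks us]]; first by rewrite big_nil scale1r.
  rewrite big_cons -scalerA -(ih us).
  set g := (fun j => if j \in s then c j *: h j else h j).
  have -> : (fun j => if j \in k :: s then c j *: h j else h j) =
            dfwith g k (c k *: h k).
    apply/funext => j; rewrite inE; have [->|jk] := eqVneq j k.
      by rewrite dfwithin.
    by rewrite dfwithout 1?eq_sym.
  rewrite cmultilin_sectionZ; congr (_ *: f _).
  apply/funext => j; have [->|jk] := eqVneq j k.
    by rewrite dfwithin /g (negbTE ks).
  by rewrite dfwithout 1?eq_sym.
rewrite -big_enum -H ?enum_uniq//; congr (f _).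
by apply/funext => j; rewrite mem_enum.
Qed.

Lemma cmultilin_bounded (f : cmultilin) :
  exists C : R, forall h : 'I_n -> V, (forall j, `|h j| <= 1) -> `|f h| <= C.
Proof.
have [_ fc] := cmultilinP f.
pose F : set_system {ptws 'I_n -> V} := filter_from [set e : R | 0 < e]
  (fun e => [set h : 'I_n -> V | forall j, `|h j| <= e]).
have FF : Filter F.
  apply: filter_from_filter; first by exists 1; rewrite /= ltr01.
  move=> d e /= d0 e0; exists (Num.min d e); first by rewrite /= lt_min d0.
  by move=> h /= hle; split=> j; move: (hle j); rewrite le_min => /andP[].
pose z : {ptws 'I_n -> V} := fun=> 0.
have Fz : F --> z.
  apply: cvg_ptws => i U /nbhs_ballP[e /= e0 eU].
  exists (e / 2); first by rewrite /= divr_gt0.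
  move=> h /= hle; apply: eU.
  rewrite -ball_normE /= sub0r normrN (le_lt_trans (hle i))//.
  by rewrite ltr_pdivrMr// ltr_pMr// ltr1n.
have [e /= e0 He] : F [set h | `|f z - f h| < 1].
  apply: Fz; apply: (fc z [set w | `|f z - w| < 1]).
  by have := nbhsx_ballx (f z) 1 ltr01; rewrite -ball_normE.
exists (e ^- n * (`|f z| + 1)) => h hle.
have H : `|f z - f (fun j => e *: h j)| < 1.
  apply: He => j /=.
  by rewrite normrZ gtr0_norm// ler_piMr// ltW.
have fe : f (fun j => e *: h j) = e ^+ n *: f h.
  have := cmultilin_homog f (fun=> e) h.
  by rewrite prodr_const card_ord.
rewrite fe in H; rewrite mulrC ler_pdivlMr ?exprn_gt0//.
have le_fh : `|e ^+ n *: f h| <= `|f z| + 1.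
  rewrite -[e ^+ n *: f h](subKr (f z)) (le_trans (ler_normB _ _))//.
  by rewrite lerD2l ltW.
by move: le_fh; rewrite normrZ normrX (gtr0_norm e0) mulrC.
Qed.

Definition opnorm (f : cmultilin) : R :=
  sup [set `|f h| | h in [set h : 'I_n -> V | forall j, `|h j| <= 1]].

Lemma opnorm_ub (f : cmultilin) (h : 'I_n -> V) :
  (forall j, `|h j| <= 1) -> `|f h| <= opnorm f.
Proof.
move=> hle; apply: ub_le_sup; last by exists h.
by have [C HC] := cmultilin_bounded f; exists C => _ [g /HC gC <-].
Qed.

Lemma opnorm_le (f : cmultilin) (C : R) :
  (forall h : 'I_n -> V, (forall j, `|h j| <= 1) -> `|f h| <= C) ->
  opnorm f <= C.
Proof.
move=> HC; apply: ge_sup; last by move=> _ [h /HC hC <-].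
by exists `|f (fun=> 0)|, (fun=> 0) => //= j; rewrite normr0.
Qed.

Lemma opnorm_ge0 (f : cmultilin) : 0 <= opnorm f.
Proof.
by rewrite (le_trans (normr_ge0 (f (fun=> 0))))// opnorm_ub// => j; rewrite normr0.
Qed.

Lemma opnormP (f : cmultilin) (h : 'I_n -> V) :
  `|f h| <= opnorm f * \prod_j `|h j|.
Proof.
have [[k /eqP hk]|h0] := pselect (exists k, h k == 0).
  have -> : h = dfwith h k (0 *: (0 : V)).
    apply/funext => j; have [->|jk] := eqVneq j k.
      by rewrite dfwithin hk scale0r.
    by rewrite dfwithout 1?eq_sym.
  rewrite cmultilin_sectionZ scale0r normr0.
  by rewrite mulr_ge0 ?opnorm_ge0 ?prodr_ge0.
have hn0 j : `|h j| != 0.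
  by rewrite normr_eq0; apply/negP => hj; apply: h0; exists j.
have -> : f h = (\prod_j `|h j|) *: f (fun j => `|h j|^-1 *: h j).
  rewrite -cmultilin_homog; congr (f _).
  by apply/funext => j; rewrite scalerA divff// scale1r.
rewrite normrZ mulrC ger0_norm ?prodr_ge0//.
rewrite ler_wpM2r ?prodr_ge0// opnorm_ub// => j.
by rewrite normrZ normfV normr_id mulVf.
Qed.

Lemma ler_opnormD (f g : cmultilin) : opnorm (f + g) <= opnorm f + opnorm g.
Proof.
apply: opnorm_le => h hle.
by rewrite (le_trans (ler_normD (f h) (g h)))// lerD// opnorm_ub.
Qed.

Lemma opnormZ (c : R) (f : cmultilin) : opnorm (c *: f) = `|c| * opnorm f.
Proof.
have le_opnormZ (e : R) (g : cmultilin) : opnorm (e *: g) <= `|e| * opnorm g.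
  apply: opnorm_le => h hle.
  by rewrite [leLHS](normrZ e (g h)) ler_wpM2l// opnorm_ub.
apply/eqP; rewrite eq_le le_opnormZ /=.
have [->|c0] := eqVneq c 0; first by rewrite normr0 mul0r opnorm_ge0.
rewrite mulrC -ler_pdivlMr ?normr_gt0// mulrC -normfV.
by have := le_opnormZ c^-1 (c *: f); rewrite scalerA mulVf// scale1r.
Qed.

Lemma opnorm0_eq0 (f : cmultilin) : opnorm f = 0 -> f = 0.
Proof.
move=> f0; apply/val_inj/funext => h.
by have := opnormP f h; rewrite f0 mul0r normr_le0 => /eqP.
Qed.

HB.instance Definition _ :=
  Lmodule_isNormed.Build R cmultilin ler_opnormD opnormZ opnorm0_eq0.

Lemma normr_cmultilinE (f : cmultilin) : `|f| = opnorm f.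
Proof. by []. Qed.

Lemma ler_norm_cmultilin (f : cmultilin) (h : 'I_n -> V) :
  `|f h| <= `|f| * \prod_j `|h j|.
Proof. exact: opnormP. Qed.

End multilinear.

Section differential_calculus.
Context {R : realType}.
Variables V W : normedModType R.

Definition cmultilin_of n (f : {ptws 'I_n -> V} -> W) : cmultilin V W n :=
  insubd 0 f.

Definition uncurry_cmultilin n (L : V -> cmultilin V W n) :
    {ptws 'I_n.+1 -> V} -> W :=
  fun h => L (h ord0) (fun j => h (lift ord0 j)).

Lemma cst_multilinear (w : W) :
  continuous_multilinear (fun _ : {ptws 'I_0 -> V} => w).
Proof. by split=> [h []//|]; exact: cst_continuous. Qed.

Lemma uncurry_multilinear n (L : {linear V -> cmultilin V W n}) :
  continuous L -> continuous_multilinear (uncurry_cmultilin L).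
Proof.
move=> Lc; split=> [h k c u v|h].
  rewrite /uncurry_cmultilin.
  have tail0 w : (fun j : 'I_n => dfwith h ord0 w (lift ord0 j)) =
                 (fun j => h (lift ord0 j)).
    by apply/funext => j; rewrite dfwithout.
  have [->|] := eqVneq k ord0.
    by rewrite !tail0 !dfwithin linearP.
  rewrite eq_sym => /unlift_some[k' -> _].
  have head w : dfwith h (lift ord0 k') w ord0 = h ord0.
    by rewrite dfwithout// eq_sym neq_lift.
  rewrite !head.
  have tailS w : (fun j : 'I_n => dfwith h (lift ord0 k') w (lift ord0 j)) =
      dfwith (fun j => h (lift ord0 j)) k' w.
    apply/funext => j; have [->|jk] := eqVneq j k'; first by rewrite !dfwithin.
    by rewrite !dfwithout 1?eq_sym// (inj_eq lift_inj).
  rewrite !tailS; exact: (cmultilinP (L (h ord0))).1.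
pose t (g : {ptws 'I_n.+1 -> V}) : {ptws 'I_n -> V} := fun j => g (lift ord0 j).
have cproj j : (fun g : {ptws 'I_n.+1 -> V} => g j) @ h --> h j.
  exact: (@proj_continuous _ (fun=> V) j h).
have Fh : Filter (nbhs h) by exact: nbhs_filter.
have ct : t @ h --> t h.
  apply: (@cvg_ptws _ _ (t @ h) (t h) (fmap_filter t Fh)) => j U.
  exact: cproj.
pose D (g : {ptws 'I_n.+1 -> V}) : cmultilin V W n := L (g ord0) - L (h ord0).
have D0 : (fun g => `|D g|) @ h --> (0 : R).
  rewrite -(normr0 (cmultilin V W n)) -(subrr (L (h ord0))).
  apply: cvg_norm; apply: cvgB; last exact: cvg_cst.
  exact: (cvg_comp _ _ (cproj ord0) (Lc (h ord0))).
have Dt0 : (fun g => D g (t g)) @ h --> (0 : W).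
  apply: norm_cvg0.
  apply: (@squeeze_cvgr _ _ _ _ (cst 0) (fun g => `|D g| * \prod_j `|t g j|)).
  - apply: nearW => g; apply/andP; split; first exact: normr_ge0.
    exact: (ler_norm_cmultilin (D g) (t g)).
  - exact: cvg_cst.
  - rewrite -(mul0r (\prod_j `|t h j|)); apply: cvgM => //.
    apply: cvg_big; first exact: mul_continuous.
    by move=> j _; apply: cvg_norm; exact: cproj.
have Ct : (fun g => L (h ord0) (t g)) @ h --> L (h ord0) (t h).
  exact: (cvg_comp _ _ ct ((cmultilinP (L (h ord0))).2 (t h))).
have E : uncurry_cmultilin L = (fun g => D g (t g) + L (h ord0) (t g)).
  by apply/funext => g; exact/esym/subrK.
have := cvgD Dt0 Ct; rewrite add0r => DC.
suff : uncurry_cmultilin L @ h --> L (h ord0) (t h) by [].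
by rewrite E; exact: DC.
Qed.

(* The n-th derivative D^n f_a as a continuous n-linear map, with            *)
(* D^(n+1) f_a (h_0, ..., h_n) = (D(D^n f)_a h_0) (h_1, ..., h_n), where the  *)
(* differential is taken in the normed space of continuous n-linear maps;    *)
(* D^n f_a is a junk value where f is not n times differentiable at a.       *)
Fixpoint nderiv (f : V -> W) n : V -> cmultilin V W n :=
  match n with
  | 0 => fun a => cmultilin_of (fun=> f a)
  | m.+1 => fun a => cmultilin_of (uncurry_cmultilin ('d (@nderiv f m) a))
  end.

Lemma cmultilin_ofE n (f : {ptws 'I_n -> V} -> W) (h : 'I_n -> V) :
  continuous_multilinear f -> cmultilin_of f h = f h.
Proof. by move=> /cmultilin_predP fm; rewrite /cmultilin_of insubdK. Qed.

Lemma nderiv0E (f : V -> W) a (h : 'I_0 -> V) : nderiv f 0 a h = f a.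
Proof. by rewrite /= cmultilin_ofE//; exact: cst_multilinear. Qed.

Lemma nderivSE (f : V -> W) n a (h : 'I_n.+1 -> V) :
  differentiable (nderiv f n) a ->
  nderiv f n.+1 a h = 'd (nderiv f n) a (h ord0) (fun j => h (lift ord0 j)).
Proof.
move=> df; rewrite /= cmultilin_ofE//.
by apply: uncurry_multilinear; exact: diff_continuous.
Qed.

Definition class_C n (f : V -> W) : Prop :=
  (forall i, (i < n)%N -> forall a, differentiable (nderiv f i) a) /\
  continuous (nderiv f n).

Definition subspace_set (E : set W) : Prop :=
  E 0 /\ forall (c : R) (u v : W), E u -> E v -> E (c *: u + v).

Definition splits (E : set W) : Prop :=
  closed E /\ exists F : set W,
    [/\ subspace_set F, closed F, E `&` F = [set 0] &
        forall w, exists u v, [/\ E u, F v & w = u + v]].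

Definition immersion n (f : V -> W) : Prop :=
  class_C n f /\ forall a : V, injective ('d f a) /\ splits (range ('d f a)).

End differential_calculus.

Definition topological_embedding (X Y : topologicalType) (f : X -> Y) : Prop :=
  [/\ continuous f, injective f &
      forall U, open U -> exists2 U', open U' & f @` U = U' `&` range f].

(* A manifold with a single global chart phi carries the topology induced by phi. *)
Definition embedded_submanifold {R : realType} {V W : normedModType R}
    {X : pointedType} {Y : choiceType} (n : nat)
    (phiX : X -> V) (phiY : Y -> W) (i : X -> Y) : Prop :=
  topological_embedding (i : initial_topology phiX -> initial_topology phiY) /\
  immersion n (phiY \o i \o pinv setT phiX).

(* LspaceType mu p1 is the quotient of the p-integrable functions by almost *)
(* everywhere equality; it is turned here into a normed space.              *)
Section Lspace_normed.
Context d (T : measurableType d) (R : realType).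
Variables (mu : {measure set T -> \bar R}) (p : \bar R) (p1 : (1 <= p)%E).

Local Notation Lf := (LfunType mu p1).
Local Notation Ls := (LspaceType mu p1).
Local Notation quo := {mfun_ mu, T >-> measurableTypeR R}.

Lemma ae_eq_Lnorm (f g : T -> R) :
  measurable_fun [set: T] f -> measurable_fun [set: T] g ->
  f = g %[ae mu] ->
  'N[mu]_p[EFin \o f]%E = 'N[mu]_p[EFin \o g]%E.
Proof.
move=> mf mg fg; rewrite unlock /Lnorm; case: p p1 => [r _|_|//].
- congr (_ `^ _)%E; apply: ge0_ae_eq_integral => //.
  + apply/measurable_EFinP.
    apply: (@measurableT_comp _ _ _ _ _ _ (@powR R ^~ r)) => //.
    exact: measurableT_comp.
  + apply/measurable_EFinP.
    apply: (@measurableT_comp _ _ _ _ _ _ (@powR R ^~ r)) => //.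
    exact: measurableT_comp.
  + by move=> x _; rewrite poweR_ge0.
  + by move=> x _; rewrite poweR_ge0.
  + by apply: filterS fg => x + _ => /(_ I) /= ->.
- case: ifPn => // _; apply: eq_ess_sup.
  by apply: filterS fg => x /(_ I) /= ->.
Qed.

Lemma Lspace_Lfun (a : Ls) : (a : T -> R) \in Lfun mu p.
Proof.
rewrite inE; apply/andP; split; rewrite inE; last exact: Lebesgue_finite.
exact: (@measurable_funPT _ _ _ _ (repr (a : quo))).
Qed.

Definition Lfun_of (a : Ls) : Lf := Lfun_Sub p1 (Lspace_Lfun a).

Definition mfunR_of (f : Lf) : {mfun T >-> measurableTypeR R} :=
  HB.pack (f : T -> measurableTypeR R)
    (isMeasurableFun.Build _ _ T (measurableTypeR R) f
      (@measurable_funPT _ _ _ _ f)).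

Definition aeEqMfun_of (f : Lf) : quo := \pi_quo%qT (mfunR_of f).

Lemma aeEqMfun_of_ae (f : Lf) : (aeEqMfun_of f : T -> R) = f %[ae mu].
Proof.
have : (repr (aeEqMfun_of f) == mfunR_of f %[mod quo])%qT.
  by apply/eqP; rewrite reprK.
by rewrite eqmodE => /asboolP.
Qed.

Lemma aeEqMfun_of_finite (f : Lf) : finite_norm mu p (aeEqMfun_of f : T -> R).
Proof.
rewrite /finite_norm (@ae_eq_Lnorm _ f)//; last exact: aeEqMfun_of_ae.
  exact: Lfunction_finite.
exact: (@measurable_funPT _ _ _ _ (repr (aeEqMfun_of f))).
Qed.

Definition Lspace_of (f : Lf) : Ls :=
  HB.pack (aeEqMfun_of f)
    (isFinLebesgue.Build d T R mu p p1 _ (aeEqMfun_of_finite f)).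

Lemma Lspace_ofE (f : Lf) : (Lspace_of f : T -> R) = f %[ae mu].
Proof. exact: aeEqMfun_of_ae. Qed.

Lemma Lspace_ae_eq (a b : Ls) : (a : T -> R) = b %[ae mu] -> a = b.
Proof.
move=> ab; have : (a : quo) = b.
  rewrite -[LHS]reprK -[RHS]reprK; apply/eqP; rewrite eqmodE; exact/asboolP.
case: a b {ab} => [a [[fa]]] [b [[fb]]] /= ab; subst b.
by rewrite (Prop_irrelevance fa fb).
Qed.

Lemma Lfun_ofK : cancel Lfun_of Lspace_of.
Proof. by move=> a; apply: Lspace_ae_eq; exact: Lspace_ofE. Qed.

Lemma eq_Lspace_of (f g : Lf) : f = g %[ae mu] -> Lspace_of f = Lspace_of g.
Proof.
move=> fg; apply: Lspace_ae_eq.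
apply: ae_eq_trans (Lspace_ofE f) _; apply: ae_eq_trans fg _.
exact/ae_eq_sym/Lspace_ofE.
Qed.

HB.instance Definition _ := gen_eqMixin Ls.
HB.instance Definition _ := gen_choiceMixin Ls.

Definition Lspace_zero : Ls := Lspace_of 0.
Definition Lspace_opp (a : Ls) : Ls := Lspace_of (- Lfun_of a).
Definition Lspace_add (a b : Ls) : Ls := Lspace_of (Lfun_of a + Lfun_of b).
Definition Lspace_scale (c : R) (a : Ls) : Ls := Lspace_of (c *: Lfun_of a).

Lemma Lspace_ofN f : Lspace_opp (Lspace_of f) = Lspace_of (- f).
Proof.
apply: eq_Lspace_of; apply: filterS (Lspace_ofE f) => x /(_ I) fE _.
exact: (congr1 (fun y : R => - y) fE).
Qed.

Lemma Lspace_ofD f g :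
  Lspace_add (Lspace_of f) (Lspace_of g) = Lspace_of (f + g).
Proof.
apply: eq_Lspace_of.
apply: filterS2 (Lspace_ofE f) (Lspace_ofE g) => x /(_ I) fE /(_ I) gE _.
exact: (congr2 (fun y z : R => y + z) fE gE).
Qed.

Lemma Lspace_ofZ c f : Lspace_scale c (Lspace_of f) = Lspace_of (c *: f).
Proof.
apply: eq_Lspace_of; apply: filterS (Lspace_ofE f) => x /(_ I) fE _.
exact: (congr1 (fun y : R => c * y) fE).
Qed.

Let LspaceW (P : Ls -> Prop) : (forall f, P (Lspace_of f)) -> forall a, P a.
Proof. by move=> Pf a; rewrite -[a]Lfun_ofK. Qed.

Lemma Lspace_addA : associative Lspace_add.
Proof.
elim/LspaceW => f; elim/LspaceW => g; elim/LspaceW => h.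
by rewrite !Lspace_ofD addrA.
Qed.

Lemma Lspace_addC : commutative Lspace_add.
Proof. by elim/LspaceW => f; elim/LspaceW => g; rewrite !Lspace_ofD addrC. Qed.

Lemma Lspace_add0 : left_id Lspace_zero Lspace_add.
Proof. by elim/LspaceW => f; rewrite Lspace_ofD add0r. Qed.

Lemma Lspace_addN : left_inverse Lspace_zero Lspace_opp Lspace_add.
Proof. by elim/LspaceW => f; rewrite Lspace_ofN Lspace_ofD addNr. Qed.

HB.instance Definition _ :=
  GRing.isZmodule.Build Ls Lspace_addA Lspace_addC Lspace_add0 Lspace_addN.

Lemma Lspace_scaleA c e a :
  Lspace_scale c (Lspace_scale e a) = Lspace_scale (c * e) a.
Proof. by elim/LspaceW: a => f; rewrite !Lspace_ofZ scalerA. Qed.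

Lemma Lspace_scale1 : left_id 1 Lspace_scale.
Proof. by elim/LspaceW => f; rewrite Lspace_ofZ scale1r. Qed.

Lemma Lspace_scaleDr : right_distributive Lspace_scale +%R.
Proof.
move=> c; elim/LspaceW => f; elim/LspaceW => g.
by rewrite -[LHS]/(Lspace_scale c (Lspace_add _ _)) -[RHS]/(Lspace_add _ _)
  !(Lspace_ofZ, Lspace_ofD) scalerDr.
Qed.

Lemma Lspace_scaleDl a : {morph Lspace_scale^~ a : c e / c + e}.
Proof.
move=> c e; elim/LspaceW: a => f.
by rewrite -[RHS]/(Lspace_add _ _) !(Lspace_ofZ, Lspace_ofD) scalerDl.
Qed.

HB.instance Definition _ := GRing.Zmodule_isLmodule.Build R Ls
  Lspace_scaleA Lspace_scale1 Lspace_scaleDr Lspace_scaleDl.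

Lemma LspaceD_ae (a b : Ls) :
  ((a + b : Ls) : T -> R) = (fun x => a x + b x) %[ae mu].
Proof. exact: Lspace_ofE. Qed.

Lemma LspaceZ_ae c (a : Ls) :
  ((c *: a : Ls) : T -> R) = (fun x => c * a x) %[ae mu].
Proof. exact: Lspace_ofE. Qed.

Lemma LspaceN_ae (a : Ls) :
  ((- a : Ls) : T -> R) = (fun x => - a x) %[ae mu].
Proof. exact: Lspace_ofE. Qed.

Lemma Lspace0_ae : ((0 : Ls) : T -> R) = cst 0 %[ae mu].
Proof. exact: Lspace_ofE. Qed.

Definition Lspace_norm (a : Ls) : R := fine 'N[mu]_p[EFin \o a]%E.

Lemma Lspace_norm_of f : Lspace_norm (Lspace_of f) = fine 'N[mu]_p[EFin \o f]%E.
Proof.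
congr fine; apply: ae_eq_Lnorm => //; last exact: Lspace_ofE.
exact: (@measurable_funPT _ _ _ _ (Lfun_of (Lspace_of f))).
Qed.

Lemma ler_Lspace_normD (a b : Ls) :
  Lspace_norm (a + b) <= Lspace_norm a + Lspace_norm b.
Proof.
elim/LspaceW: a => f; elim/LspaceW: b => g.
by rewrite -[_ + _]/(Lspace_add _ _) Lspace_ofD !Lspace_norm_of ler_LnormD.
Qed.

Lemma Lspace_normZ (c : R) (a : Ls) :
  Lspace_norm (c *: a) = `|c| * Lspace_norm a.
Proof.
elim/LspaceW: a => f.
rewrite -[_ *: _]/(Lspace_scale _ _) Lspace_ofZ !Lspace_norm_of.
by rewrite -[LHS]/(fine 'N[mu]_p[EFin \o (c \*: f)]%E) LnormZ -finite_norm_fine.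
Qed.

Lemma Lspace_norm0_eq0 (a : Ls) : Lspace_norm a = 0 -> a = 0.
Proof.
elim/LspaceW: a => f; rewrite Lspace_norm_of => /fine_Lnormr_eq0 f0.
exact: eq_Lspace_of.
Qed.

HB.instance Definition _ := Lmodule_isNormed.Build R Ls
  ler_Lspace_normD Lspace_normZ Lspace_norm0_eq0.

Lemma Lspace_normE (a : Ls) : `|a| = fine 'N[mu]_p[EFin \o a]%E.
Proof. by []. Qed.

End Lspace_normed.

Section Lspace0.
Context d (T : measurableType d) (R : realType).
Variables (mu : probability T R) (p : \bar R) (p1 : (1 <= p)%E).

Local Notation Ls := (LspaceType mu p1).

Lemma Lspace_Lfun1 (a : Ls) : (a : T -> R) \in Lfun mu 1.
Proof.
apply: (@Lfun_subset _ _ _ mu 1 p) (Lspace_Lfun a) => //.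
exact: fin_num_measure.
Qed.

Lemma ae_eq_expectation (f g : T -> R) :
  measurable_fun [set: T] f -> measurable_fun [set: T] g ->
  f = g %[ae mu] -> ('E_mu[f] = 'E_mu[g])%E.
Proof.
move=> mf mg fg; rewrite unlock; apply: ae_eq_integral => //.
- exact/measurable_EFinP.
- exact/measurable_EFinP.
- by apply: filterS fg => x + _ => /(_ I) ->.
Qed.

Lemma Lfun_measurable q (f : T -> R) :
  f \in Lfun mu q -> measurable_fun [set: T] f.
Proof. by rewrite inE => /andP[]; rewrite inE. Qed.

Lemma expectation_lincomb (c : R) (a b : Ls) :
  ('E_mu[(c *: a + b : Ls)] = c%:E * 'E_mu[a] + 'E_mu[b])%E.
Proof.
have ca1 : (c \o* (a : T -> R)) \in Lfun mu 1 by exact: Lfun_scale (Lspace_Lfun1 a).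
rewrite -expectationZl ?Lspace_Lfun1// -expectationD ?Lspace_Lfun1//.
apply: ae_eq_expectation.
- exact: Lfun_measurable (Lspace_Lfun _).
- by apply: measurable_funD; apply: Lfun_measurable ca1 || exact: Lfun_measurable (Lspace_Lfun _).
- apply: filterS2 (LspaceD_ae (c *: a) b) (LspaceZ_ae c a) => x + + _.
  by move=> /(_ I) -> /(_ I) ->; rewrite mulrC.
Qed.

Definition Lspace0_pred : {pred Ls} := [pred a : Ls | 'E_mu[a]%E == 0%E].

Record Lspace0 := MkLspace0 {
  Lspace0_val :> Ls ;
  _ : Lspace0_val \in Lspace0_pred }.

HB.instance Definition _ := [isSub for Lspace0_val].
HB.instance Definition _ := [Choice of Lspace0 by <:].

Lemma Lspace0_submod_closed : submod_closed Lspace0_pred.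
Proof.
split=> [|c a b].
  rewrite inE (@ae_eq_expectation _ (cst 0)) ?expectation_cst//.
    exact: Lfun_measurable (Lspace_Lfun _).
  exact: Lspace0_ae.
rewrite !inE => /eqP a0 /eqP b0.
by rewrite expectation_lincomb a0 b0 mule0 adde0.
Qed.

HB.instance Definition _ :=
  GRing.isSubmodClosed.Build _ _ Lspace0_pred Lspace0_submod_closed.
HB.instance Definition _ := [SubChoice_isSubLmodule of Lspace0 by <:].

Definition Lspace0_norm (a : Lspace0) : R := `|a : Ls|.

Lemma ler_Lspace0_normD (a b : Lspace0) :
  Lspace0_norm (a + b) <= Lspace0_norm a + Lspace0_norm b.
Proof. exact: ler_normD. Qed.

Lemma Lspace0_normZ (c : R) (a : Lspace0) :
  Lspace0_norm (c *: a) = `|c| * Lspace0_norm a.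
Proof. exact: normrZ. Qed.

Lemma Lspace0_norm0_eq0 (a : Lspace0) : Lspace0_norm a = 0 -> a = 0.
Proof. by move=> /normr0_eq0 a0; exact/val_inj. Qed.

HB.instance Definition _ := Lmodule_isNormed.Build R Lspace0
  ler_Lspace0_normD Lspace0_normZ Lspace0_norm0_eq0.

Lemma Lspace0_normE (a : Lspace0) : `|a| = `|a : Ls|.
Proof. by []. Qed.

End Lspace0.

Section measure_manifolds.
Local Open Scope charge_scope.
Context d (T : measurableType d) (R : realType).
Variable mu : probability T R.

(* Library measures are functions on all of set T; requiring the value 0 off *)
(* the sigma-algebra makes Leibniz equality coincide with equality of        *)
(* measures, i.e. equality on measurable sets.                               *)
Record finmeas := FinMeas {
  finmeas_measure :> {finite_measure set T -> \bar R} ;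
  _ : forall A, ~ measurable A -> finmeas_measure A = 0%E }.

Lemma finmeas_ext (P Q : finmeas) :
  (forall A, measurable A -> P A = Q A) -> P = Q.
Proof.
move=> PQ.
have {PQ} : (P : set T -> \bar R) = Q.
  apply/funext => A; have [/PQ//|mA] := pselect (measurable A).
  by case: P Q {PQ} => [P P0] [Q Q0] /=; rewrite P0// Q0.
case: P Q => [P P0] [Q Q0] /= PQ.
suff PQ' : P = Q by subst Q; rewrite (Prop_irrelevance P0 Q0).
case: P Q PQ {P0 Q0} => [P [[a1 a2] [a3] [a4] [a5] [a6]]].
case=> [Q [[b1 b2] [b3] [b4] [b5] [b6]]] /= PQ; subst Q.
rewrite (Prop_irrelevance a1 b1) (Prop_irrelevance a2 b2).
rewrite (Prop_irrelevance a3 b3) (Prop_irrelevance a4 b4).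
by rewrite (Prop_irrelevance a5 b5) (Prop_irrelevance a6 b6).
Qed.

Definition density (P : finmeas) : T -> R :=
  fun x => fine (('d (charge_of_finite_measure P) '/d mu) x).

Lemma measurable_density (P : finmeas) :
  P `<< mu -> measurable_fun [set: T] (density P).
Proof.
move=> Pmu; apply: measurableT_comp; first exact: fine_measurable.
by apply: (measurable_int mu); exact: Radon_Nikodym_integrable.
Qed.

Lemma density_ge0 (P : finmeas) :
  P `<< mu -> {ae mu, forall x, 0 <= density P x}.
Proof.
move=> Pmu; have := ae_eq_Radon_Nikodym_SigmaFinite Pmu measurableT.
apply: filterS => x /(_ I) fx; rewrite /density -fx.
by rewrite fine_ge0// Radon_Nikodym_SigmaFinite.f_ge0.
Qed.

Variable lambda : R.

Record Mtilde := MkMtilde {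
  Mtilde_finmeas :> finmeas ;
  Mtilde_ac : Mtilde_finmeas `<< mu ;
  Mtilde_ca : mu `<< Mtilde_finmeas ;
  Mtilde_density :
    ('E_mu[fun x => (density Mtilde_finmeas x `^ lambda)%R] < +oo)%E ;
  Mtilde_ln_density :
    ('E_mu[fun x => (`|ln (density Mtilde_finmeas x)| `^ lambda)%R] < +oo)%E }.

HB.instance Definition _ := gen_eqMixin Mtilde.
HB.instance Definition _ := gen_choiceMixin Mtilde.

Record Mprob := MkMprob {
  inclusion :> Mtilde ;
  Mprob_density : 'E_mu[density inclusion]%E = 1%E }.

HB.instance Definition _ := gen_eqMixin Mprob.
HB.instance Definition _ := gen_choiceMixin Mprob.

(* mu itself is a point of Mprob, which makes pinv available on charts. *)
Definition mu_on (A : set T) : \bar R := if `[< measurable A >] then mu A else 0%E.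

Lemma mu_onE A : measurable A -> mu_on A = mu A.
Proof. by move=> mA; rewrite /mu_on asboolT. Qed.

Let mu_on0 : mu_on set0 = 0%E.
Proof. by rewrite mu_onE. Qed.

Let mu_on_ge0 A : (0 <= mu_on A)%E.
Proof. by rewrite /mu_on; case: ifP. Qed.

Let mu_on_sigma_additive : semi_sigma_additive mu_on.
Proof.
move=> F mF tF mUF; rewrite mu_onE//.
under eq_fun do under eq_bigr do rewrite mu_onE//.
exact: measure_semi_sigma_additive.
Qed.

HB.instance Definition _ := isMeasure.Build _ _ _ mu_on
  mu_on0 mu_on_ge0 mu_on_sigma_additive.

Let mu_on_fin : fin_num_fun mu_on.
Proof. by move=> A mA; rewrite mu_onE// fin_num_measure. Qed.

HB.instance Definition _ := Measure_isFinite.Build _ _ _ mu_on mu_on_fin.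

Let mu_on_off A : ~ measurable A -> mu_on A = 0%E.
Proof. by move=> mA; rewrite /mu_on asboolF. Qed.

Definition mu_finmeas : finmeas := @FinMeas mu_on mu_on_off.

Let mu_ac : mu_finmeas `<< mu.
Proof. by apply/null_content_dominatesP => A mA muA; rewrite -muA; exact: mu_onE. Qed.

Let mu_ca : mu `<< mu_finmeas.
Proof. by apply/null_content_dominatesP => A mA; rewrite -(mu_onE mA). Qed.

Let mu_density1 : density mu_finmeas = cst 1 %[ae mu].
Proof.
have H : ae_eq mu setT
    ('d (charge_of_finite_measure mu_finmeas) '/d mu) (cst 1%E).
  apply: integral_ae_eq => //; first exact: Radon_Nikodym_integrable.
  move=> E _ mE; rewrite -Radon_Nikodym_integral// integral_cst// mul1e.
  exact: mu_onE.
by apply: filterS H => x /(_ I); rewrite /density => ->.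
Qed.

Let mu_expectation (g : R -> R) : measurable_fun [set: R] g ->
  ('E_mu[g \o density mu_finmeas] = (g 1)%:E)%E.
Proof.
move=> mg; rewrite -(expectation_cst mu (g 1)); apply: ae_eq_expectation => //.
  by apply: measurableT_comp => //; exact: measurable_density.
by apply: filterS mu_density1 => x /(_ I) /= ->.
Qed.

Let mu_Mtilde1 :
  ('E_mu[fun x => (density mu_finmeas x `^ lambda)%R] < +oo)%E.
Proof.
rewrite [ltLHS](mu_expectation (g := fun y => y `^ lambda)) ?ltry//.
Qed.

Let mu_Mtilde2 :
  ('E_mu[fun x => (`|ln (density mu_finmeas x)| `^ lambda)%R] < +oo)%E.
Proof.
rewrite [ltLHS](mu_expectation (g := fun y => `|ln y| `^ lambda)) ?ltry//.
apply: (@measurableT_comp _ _ _ _ _ _ (@powR R ^~ lambda)).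
  exact: measurable_powR.
by apply: measurableT_comp => //; exact: measurable_ln.
Qed.

Definition mu_Mtilde : Mtilde := MkMtilde mu_ac mu_ca mu_Mtilde1 mu_Mtilde2.

Let mu_Mprob1 : 'E_mu[density mu_Mtilde]%E = 1%E.
Proof. by rewrite [LHS](mu_expectation (g := id)). Qed.

HB.instance Definition _ := isPointed.Build Mprob (MkMprob mu_Mprob1).

Variable lambda1 : (1 <= lambda%:E)%E.

Local Notation Ls := (LspaceType mu lambda1).

Let lambda_gt0 : 0 < lambda.
Proof. by rewrite (lt_le_trans ltr01)// -lee_fin. Qed.

Lemma Lfun_expectation (f : T -> R) : measurable_fun [set: T] f ->
  ('E_mu[fun x => (`|f x| `^ lambda)%R] < +oo)%E -> f \in Lfun mu lambda%:E.
Proof.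
move=> mf; rewrite [in X in X -> _]unlock => foo.
rewrite inE; apply/andP; split; rewrite inE//=.
by rewrite /finite_norm unlock /= poweR_lty.
Qed.

Lemma chart_Lfun (P : Mtilde) :
  (fun x => density P x - 1 + ln (density P x)) \in Lfun mu lambda%:E.
Proof.
have mp := measurable_density (Mtilde_ac P).
have mlp : measurable_fun [set: T] (fun x => ln (density P x)).
  by apply: measurableT_comp => //; exact: measurable_ln.
have dL : density P \in Lfun mu lambda%:E.
  apply: Lfun_expectation => //; rewrite (@ae_eq_expectation _ _ _ _ _ (fun x => density P x `^ lambda)).
  - exact: Mtilde_density.
  - apply: (@measurableT_comp _ _ _ _ _ _ (@powR R ^~ lambda)) => //.
    exact: measurableT_comp.
  - exact: (@measurableT_comp _ _ _ _ _ _ (@powR R ^~ lambda)).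
  - by apply: filterS (density_ge0 (Mtilde_ac P)) => x p0 _; rewrite ger0_norm.
have lL : (fun x => ln (density P x)) \in Lfun mu lambda%:E.
  by apply: Lfun_expectation => //; exact: Mtilde_ln_density.
have cL : cst (1 : R) \in Lfun mu lambda%:E by exact: Lfun_cst.
have := valP (Lfun_Sub lambda1 dL - Lfun_Sub lambda1 cL + Lfun_Sub lambda1 lL).
by [].
Qed.

Definition Lspace_cst (c : R) : Ls :=
  Lspace_of (Lfun_Sub lambda1 (Lfun_cst mu c lambda)).

Lemma center_subproof (a : Ls) :
  a - Lspace_cst (fine 'E_mu[a]%E) \in @Lspace0_pred _ _ _ mu _ lambda1.
Proof.
rewrite inE addrC -scaleN1r expectation_lincomb.
rewrite (@ae_eq_expectation _ _ _ _ (Lspace_cst _) (cst (fine 'E_mu[a]%E))) //.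
- rewrite expectation_cst fineK ?expectation_fin_num ?Lspace_Lfun1//.
  by rewrite EFinN mulN1e addeC subee ?expectation_fin_num ?Lspace_Lfun1.
- exact: Lfun_measurable (Lspace_Lfun _).
- exact: Lspace_ofE.
Qed.

Definition center (a : Ls) : Lspace0 mu lambda1 :=
  MkLspace0 (center_subproof a).

Definition chart_tilde (P : Mtilde) : Ls :=
  Lspace_of (Lfun_Sub lambda1 (chart_Lfun P)).

Definition chart (P : Mprob) : Lspace0 mu lambda1 := center (chart_tilde P).

End measure_manifolds.

Arguments Mtilde {d T R} mu lambda.
Arguments Mprob {d T R} mu lambda.
Arguments inclusion {d T R} mu lambda _.
Arguments chart_tilde {d T R} mu {lambda} lambda1 _.
Arguments chart {d T R} mu {lambda} lambda1 _.

Lemma le1_of_le2 (R : realType) (lambda : R) :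
  2 <= lambda -> (1 <= lambda%:E)%E.
Proof. by rewrite lee_fin; apply: le_trans; rewrite ler1n. Qed.

(* Main.v *)
From Pilot Require Import Defs.
From HB Require Import structures.
From mathcomp Require Import all_boot all_order all_algebra.
From mathcomp Require Import all_classical all_reals all_analysis.
From mathcomp Require Import measurable_realfun.
From mathcomp Require Import ring lra.

(** The chart value of a measure with density [p] is [p - 1 + ln p], and on the
real line [y |-> y - 1 + ln y] is an increasing bijection from the positive
numbers, with inverse [dens]. The two charts of a probability measure differ by
the constant [E (ln p)]; hence, in charts, the inclusion of probability measures
into finite measures is [rho a = a + log_mean a], where the number [log_mean a]
is determined by [E (dens (a + log_mean a)) = 1]. It exists and is unique because
the total mass [E (dens b)] is convex, at most 1 after a suitable downward shift
of [b], and strictly increasing along the constants where it equals 1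
([mass_small], [mass_tangent]). This makes the chart of
probability measures a bijection.

Implicit differentiation gives the derivative of [log_mean] at [a] in the
direction [h] as minus [E (dens' (rho a) h) / E (dens' (rho a))]. As [dens'] is a
polynomial in [q = 1 / (1 + dens)] and [q'] is one too, all further derivatives
are rational expressions in means of the form
[E (P (q (rho a)) * h_1 * ... * h_n)] with [P] a polynomial ([rho_mean]), and the
only denominator is [E (dens' (rho a))]. Two estimates carry the analysis:
- Products of [n < l] functions from a ball of [L^l] are uniformly integrable, so
  such a mean depends continuously on [rho a], uniformly in the directions
  ([Ex_weight_prod]); one derivative costs one more factor. The order of
  differentiability is the largest [n < l] for this reason.
- Since [E p = 1], the denominator is at least [1 / (1 + E (p ^ 2))]; as
  [p <= 1 + `|a|] and [2 <= l], it is bounded below on bounded sets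
  ([mass_slope_ge], [mass_slope_rho_ge]).

To differentiate repeatedly without spaces of multilinear maps, the directions
are kept as parameters: [smooth_fam k F] says that a family [F a (h_0, h_1, ...)]
has [k] derivatives in [a], uniformly for directions in a ball and bounded for
[a] in a ball. These families are stable under sums, products, reciprocals and
reindexing of the directions, and [nderiv_smooth_fam] identifies the iterated
Frechet derivatives with the successive families. Boundedness on bounded sets,
the third claim, is part of the notion.

Finally, centring [b |-> b - E b] is a continuous linear left inverse of [rho].
So the inclusion is a topological embedding ([initial_topology_embedding]), and
the differential of [rho] has the same left inverse, which makes it injective
with range complemented by the constants ([left_inverse_immersion]). *)

Import Order.TTheory GRing.Theory Num.Theory.
Import numFieldNormedType.Exports.

Local Open Scope classical_set_scope.
Local Open Scope ring_scope.

Set Implicit Arguments.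
Unset Strict Implicit.
Unset Printing Implicit Defensive.

(** * Families of maps with finitely many continuous derivatives *)

Section uniform_calculus.
Context {R : realType} {V : normedModType R}.

Definition scons (h : V) (hs : nat -> V) : nat -> V :=
  fun j => if j is i.+1 then hs i else h.

(** Sequences of directions are infinite so that families of different arity can
be multiplied and reindexed freely; a derivative puts its direction in front. *)
Definition seq_bounded (r : R) (hs : nat -> V) := forall j, `|hs j| <= r.

Lemma seq_bounded_scons r h hs :
  `|h| <= r -> seq_bounded r hs -> seq_bounded r (scons h hs).
Proof. by move=> hr hsr [|j] /=. Qed.

Lemma seq_boundedW r s hs : r <= s -> seq_bounded r hs -> seq_bounded s hs.
Proof. by move=> rs hsr j; exact: le_trans rs. Qed.

Section definitions.
Context {W : normedModType R}.
Implicit Types F : V -> (nat -> V) -> W.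

Definition unif_continuous_fam F := forall (a : V) (r e : R), 0 < e ->
  \forall b \near a, forall hs, seq_bounded r hs -> `|F b hs - F a hs| <= e.

Definition bounded_fam F := forall r : R, exists2 K : R, 0 <= K &
  forall a hs, `|a| <= r -> seq_bounded r hs -> `|F a hs| <= K.

Definition head_linear F := forall a hs (c : R) u v,
  F a (scons (c *: u + v) hs) = c *: F a (scons u hs) + F a (scons v hs).

(** The derivative of a family is again a family, with the direction of
differentiation as its new first argument. *)
Definition unif_derivative F F' := forall (a : V) (r e : R), 0 < e ->
  \forall h \near (0 : V), forall hs, seq_bounded r hs ->
    `|F (a + h) hs - F a hs - F' a (scons h hs)| <= e * `|h|.

Fixpoint smooth_fam k F : Prop :=
  [/\ unif_continuous_fam F, bounded_fam F &
    if k is k'.+1 then exists F',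
      [/\ head_linear F', unif_derivative F F' & smooth_fam k' F']
    else True].

Lemma smooth_fam_cont k F : smooth_fam k F -> unif_continuous_fam F.
Proof. by case: k => [|k] []. Qed.

Lemma smooth_fam_bounded k F : smooth_fam k F -> bounded_fam F.
Proof. by case: k => [|k] []. Qed.

Lemma smooth_famS k F : smooth_fam k.+1 F -> smooth_fam k F.
Proof.
elim: k F => [|k IH] F; first by case=> ? ? _.
case=> cF bF [F' [lF' dF sF']]; split=> //; exists F'; split=> //.
exact: IH.
Qed.

Lemma head_linear0 F a hs : head_linear F -> F a (scons 0 hs) = 0.
Proof.
move=> lF; have := lF a hs 1 0 0; rewrite scaler0 addr0 scale1r => /eqP.
by rewrite -[X in X == _]addr0 (inj_eq (addrI _)) => /eqP <-.
Qed.

Lemma head_linearZ F a hs c h : head_linear F ->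
  F a (scons (c *: h) hs) = c *: F a (scons h hs).
Proof.
by move=> lF; have := lF a hs c h 0; rewrite addr0 head_linear0// addr0.
Qed.

(** Normalizing the head reduces to a head in the unit ball. *)
Lemma head_bounded F : head_linear F -> bounded_fam F ->
  forall r : R, exists2 K : R, 0 <= K & forall a h hs,
    `|a| <= r -> seq_bounded r hs -> `|F a (scons h hs)| <= K * `|h|.
Proof.
move=> lF bF r; have [K K0 HK] := bF (Num.max r 1).
exists K => // a h hs ar hsr.
have [->|h0] := eqVneq h 0; first by rewrite head_linear0// !normr0 mulr0.
have -> : h = `|h| *: (`|h|^-1 *: h).
  by rewrite scalerA divff ?normr_eq0// scale1r.
rewrite head_linearZ// !normrZ normr_id normfV normr_id mulVf ?normr_eq0//.
rewrite mulr1 mulrC ler_wpM2r//; apply: HK; first by rewrite le_max ar.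
apply: seq_bounded_scons; last by apply: seq_boundedW hsr; rewrite le_max lexx.
by rewrite normrZ normfV normr_id mulVf ?normr_eq0// le_max lexx orbT.
Qed.

Lemma unif_derivativeC F F' :
  (forall a r, exists2 C : R, 0 <= C & forall e : R, 0 < e ->
    \forall h \near (0 : V), forall hs, seq_bounded r hs ->
      `|F (a + h) hs - F a hs - F' a (scons h hs)| <= C * e * `|h|) ->
  unif_derivative F F'.
Proof.
move=> H a r e e0; have [C C0 HC] := H a r.
have e'0 : 0 < e / (C + 1) by rewrite divr_gt0// ltr_wpDl.
apply: filterS (HC _ e'0) => h + hs hsr => /(_ hs hsr) /le_trans; apply.
rewrite ler_wpM2r// mulrCA ger_pMr// ler_pdivrMr ?ltr_wpDl// mul1r.
by rewrite lerDl.
Qed.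

Lemma unif_continuousC F :
  (forall a r, exists2 C : R, 0 <= C & forall e : R, 0 < e ->
    \forall b \near a, forall hs, seq_bounded r hs ->
      `|F b hs - F a hs| <= C * e) -> unif_continuous_fam F.
Proof.
move=> H a r e e0; have [C C0 HC] := H a r.
have e'0 : 0 < e / (C + 1) by rewrite divr_gt0// ltr_wpDl.
apply: filterS (HC _ e'0) => h + hs hsr => /(_ hs hsr) /le_trans; apply.
rewrite mulrCA ger_pMr// ler_pdivrMr ?ltr_wpDl// mul1r.
by rewrite lerDl.
Qed.

Lemma smooth_fam_const_in_point k (m : (nat -> V) -> W) :
  (forall r : R, exists2 K : R, 0 <= K &
     forall hs, seq_bounded r hs -> `|m hs| <= K) ->
  smooth_fam k (fun=> m).
Proof.
have cst_cont (l : (nat -> V) -> W) : unif_continuous_fam (fun=> l).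
  move=> a r e e0; apply: nearW => b hs _.
  by rewrite subrr normr0 ltW.
have bz : bounded_fam (fun _ _ => 0 : W).
  by move=> r; exists 0 => // a hs _ _; rewrite normr0.
have d0 (l : (nat -> V) -> W) : unif_derivative (fun=> l) (fun _ _ => 0).
  move=> a r e e0; apply: nearW => h hs _.
  by rewrite subrr subr0 normr0 mulr_ge0// ltW.
have l0 : head_linear (fun _ _ => 0 : W).
  by move=> *; rewrite scaler0 addr0.
have s0 j : smooth_fam j (fun _ _ => 0 : W).
  by elim: j => [|j IH]; split=> //; exists (fun _ _ => 0); split.
move=> bm.
have bm' : bounded_fam (fun=> m).
  by move=> r; have [K K0 HK] := bm r; exists K => // a hs _; exact: HK.
by case: k => [|k]; split=> //; exists (fun _ _ => 0); split.
Qed.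

Lemma smooth_fam_cst k (w : W) : smooth_fam k (fun _ _ => w).
Proof. by apply: smooth_fam_const_in_point => r; exists `|w|. Qed.

Lemma unif_continuous_famD F G : unif_continuous_fam F ->
  unif_continuous_fam G -> unif_continuous_fam (fun a hs => F a hs + G a hs).
Proof.
move=> cF cG a r e e0; have e2 : 0 < e / 2 by rewrite divr_gt0.
apply: filterS2 (cF a r _ e2) (cG a r _ e2) => b HF HG hs hsr.
rewrite opprD addrACA (le_trans (ler_normD _ _))// (splitr e).
by rewrite lerD ?HF ?HG.
Qed.

Lemma bounded_famD F G : bounded_fam F -> bounded_fam G ->
  bounded_fam (fun a hs => F a hs + G a hs).
Proof.
move=> bF bG r; have [K K0 HK] := bF r; have [L L0 HL] := bG r.
exists (K + L); [exact: addr_ge0|move=> a hs ar hsr].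
by rewrite (le_trans (ler_normD _ _))// lerD ?HK ?HL.
Qed.

Lemma unif_derivativeD F G F' G' :
  unif_derivative F F' -> unif_derivative G G' ->
  unif_derivative (fun a hs => F a hs + G a hs)
    (fun a hs => F' a hs + G' a hs).
Proof.
move=> dF dG a r e e0; have e2 : 0 < e / 2 by rewrite divr_gt0.
apply: filterS2 (dF a r _ e2) (dG a r _ e2) => h HF HG hs hsr.
rewrite (opprD (F a hs)) (addrACA (F (a + h) hs)) (opprD (F' _ _)) [X in `|X|]addrACA.
rewrite (le_trans (ler_normD _ _))// (splitr e) mulrDl.
by rewrite lerD ?HF ?HG.
Qed.

Lemma smooth_famD k F G : smooth_fam k F -> smooth_fam k G ->
  smooth_fam k (fun a hs => F a hs + G a hs).
Proof.
elim: k F G => [|k IH] F G.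
  case=> cF bF _ [cG bG _]; split=> //; first exact: unif_continuous_famD.
  exact: bounded_famD.
case=> cF bF [F' [lF dF sF']] [cG bG [G' [lG dG sG']]].
split; [exact: unif_continuous_famD|exact: bounded_famD|].
exists (fun a hs => F' a hs + G' a hs).
split; [|exact: unif_derivativeD|exact: IH].
by move=> a hs c u v; rewrite lF lG scalerDr addrACA.
Qed.

End definitions.


Lemma near_norm_le (a : V) : \forall b \near a, `|b| <= `|a| + 1.
Proof.
have : \forall b \near a, `|a - b| < 1.
  by have := nbhsx_ballx a 1 ltr01; rewrite -ball_normE.
apply: filterS => b ab; rewrite -[b](subKr a) (le_trans (ler_normB _ _))//.
by rewrite lerD2l ltW.
Qed.

Lemma near_shift0 (a : V) (P : V -> Prop) :
  (\forall b \near a, P b) -> \forall h \near (0 : V), P (a + h).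
Proof.
move=> aP; have c : (fun h => a + h) @ (0 : V) --> a + 0.
  by apply: cvgD; [exact: cvg_cst|exact: cvg_id].
by rewrite addr0 in c; exact: c.
Qed.

Section reindexing.
Context {W : normedModType R}.
Implicit Types F : V -> (nat -> V) -> W.

Definition shift_index (s : nat -> nat) (j : nat) : nat :=
  if j is i.+1 then (s i).+1 else 0%N.

Lemma scons_shift_index s h hs :
  scons h hs \o shift_index s = scons h (hs \o s).
Proof. by apply/funext; case. Qed.

Lemma unif_continuous_fam_reindex F s : unif_continuous_fam F ->
  unif_continuous_fam (fun a hs => F a (hs \o s)).
Proof.
move=> cF a r e e0; apply: filterS (cF a r e e0) => b H hs hsr.
by apply: H => j; exact: hsr.
Qed.

Lemma bounded_fam_reindex F s : bounded_fam F ->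
  bounded_fam (fun a hs => F a (hs \o s)).
Proof.
move=> bF r; have [K K0 HK] := bF r; exists K => // a hs ar hsr.
by apply: HK => // j; exact: hsr.
Qed.

Lemma smooth_fam_reindex k F s : smooth_fam k F ->
  smooth_fam k (fun a hs => F a (hs \o s)).
Proof.
elim: k F s => [|k IH] F s.
  case=> cF bF _; split=> //; first exact: unif_continuous_fam_reindex.
  exact: bounded_fam_reindex.
case=> cF bF [F' [lF dF sF']].
split; [exact: unif_continuous_fam_reindex|exact: bounded_fam_reindex|].
exists (fun a hs => F' a (hs \o shift_index s)); split; last exact: IH.
- by move=> a hs c u v; rewrite !scons_shift_index lF.
- move=> a r e e0; apply: filterS (dF a r e e0) => h H hs hsr.
  by rewrite scons_shift_index; apply: H => j; exact: hsr.
Qed.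

End reindexing.

Section products.
Context {W : normedModType R}.
Implicit Types (F : V -> (nat -> V) -> W) (f : V -> (nat -> V) -> R).

Lemma unif_continuous_famZ f F :
  unif_continuous_fam f -> bounded_fam f ->
  unif_continuous_fam F -> bounded_fam F ->
  unif_continuous_fam (fun a hs => f a hs *: F a hs).
Proof.
move=> cf bf cF bF; apply: unif_continuousC => a r.
have [K K0 HK] := bf (Num.max r (`|a| + 1)).
have [L L0 HL] := bF (Num.max r (`|a| + 1)).
exists (K + L) => [|e e0]; first exact: addr_ge0.
apply: filterS3 (near_norm_le a) (cf a r e e0) (cF a r e e0).
move=> b ba Hf HF hs hsr.
have hsr' : seq_bounded (Num.max r (`|a| + 1)) hs.
  by apply: seq_boundedW hsr; rewrite le_max lexx.
have -> : f b hs *: F b hs - f a hs *: F a hs =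
    f b hs *: (F b hs - F a hs) + (f b hs - f a hs) *: F a hs.
  by rewrite scalerBr scalerBl addrA subrK.
rewrite (le_trans (ler_normD _ _))// !normrZ mulrDl lerD//.
  by rewrite ler_pM// ?HF// HK// le_max ba orbT.
by rewrite mulrC ler_pM// ?Hf// HL// le_max lerDl ler01 orbT.
Qed.

Lemma bounded_famZ f F : bounded_fam f -> bounded_fam F ->
  bounded_fam (fun a hs => f a hs *: F a hs).
Proof.
move=> bf bF r; have [K K0 HK] := bf r; have [L L0 HL] := bF r.
exists (K * L); [exact: mulr_ge0|move=> a hs ar hsr].
by rewrite normrZ ler_pM// ?HK ?HL.
Qed.

(** Leibniz rule. In each term the undifferentiated factor ignores the new head,
hence the reindexing by [S]. *)
Lemma unif_derivativeZ f F f' F' :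
  bounded_fam f -> unif_continuous_fam F -> bounded_fam F ->
  head_linear f' -> bounded_fam f' ->
  unif_derivative f f' -> unif_derivative F F' ->
  unif_derivative (fun a hs => f a hs *: F a hs)
    (fun a hs => f' a hs *: F a (hs \o S) + f a (hs \o S) *: F' a hs).
Proof.
move=> bf cF bF lf' bf' df dF; apply: unif_derivativeC => a r.
set m := Num.max r (`|a| + 1).
have [K K0 HK] := bf m; have [L L0 HL] := bF m.
have [K' K'0 HK'] := head_bounded lf' bf' m.
exists (K + L + K') => [|e e0]; first by rewrite !addr_ge0.
near=> h.
have bm : `|a + h| <= m.
  rewrite le_max; apply/orP; right.
  by near: h; exact: near_shift0 (near_norm_le a).
have Hf : forall hs, seq_bounded r hs ->
  `|f (a + h) hs - f a hs - f' a (scons h hs)| <= e * `|h|.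
  by near: h; exact: df.
have HF : forall hs, seq_bounded r hs ->
  `|F (a + h) hs - F a hs - F' a (scons h hs)| <= e * `|h|.
  by near: h; exact: dF.
have Hc : forall hs, seq_bounded r hs -> `|F (a + h) hs - F a hs| <= e.
  by near: h; exact: near_shift0 (cF a r e e0).
move=> hs hsr.
have hsr' : seq_bounded m hs by apply: seq_boundedW hsr; rewrite le_max lexx.
have am : `|a| <= m by rewrite le_max lerDl ler01 orbT.
have -> : scons h hs \o S = hs by [].
pose u := f (a + h) hs - f a hs - f' a (scons h hs).
pose v := F (a + h) hs - F a hs - F' a (scons h hs).
pose w := F (a + h) hs - F a hs.
have -> : f (a + h) hs *: F (a + h) hs - f a hs *: F a hs -
  (f' a (scons h hs) *: F a hs + f a hs *: F' a (scons h hs)) =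
  u *: F (a + h) hs + f' a (scons h hs) *: w + f a hs *: v.
  have -> : f (a + h) hs *: F (a + h) hs = u *: F (a + h) hs +
      f' a (scons h hs) *: F (a + h) hs + f a hs *: F (a + h) hs.
    by rewrite -!scalerDl; congr (_ *: _); rewrite /u; ring.
  rewrite opprD -(addrA (_ + _)) (addrCA (- (f a hs *: F a hs))) [LHS]addrACA.
  by rewrite -(addrA (u *: _)) (addrA (f a hs *: _)) -!scalerBr.
have -> : (K + L + K') * e * `|h| =
  (L * e * `|h| + K' * e * `|h|) + K * e * `|h| by ring.
have H1 : `|u *: F (a + h) hs| <= L * e * `|h|.
  by rewrite normrZ mulrC -mulrA ler_pM// ?HL// Hf.
have H2 : `|f' a (scons h hs) *: w| <= K' * e * `|h|.
  by rewrite normrZ mulrAC ler_pM// ?HK'// Hc.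
have H3 : `|f a hs *: v| <= K * e * `|h|.
  by rewrite normrZ -mulrA ler_pM// ?HK// HF.
by rewrite (le_trans (ler_normD _ _))// lerD// (le_trans (ler_normD _ _))// lerD.
Unshelve. all: by end_near. Qed.

Lemma smooth_famZ k f F : smooth_fam k f -> smooth_fam k F ->
  smooth_fam k (fun a hs => f a hs *: F a hs).
Proof.
elim: k f F => [|k IH] f F.
  case=> cf bf _ [cF bF _]; split=> //; first exact: unif_continuous_famZ.
  exact: bounded_famZ.
move=> sf sF; have [cf bf [f' [lf df sf']]] := sf.
have [cF bF [F' [lF dF sF']]] := sF.
split; [exact: unif_continuous_famZ|exact: bounded_famZ|].
exists (fun a hs => f' a hs *: F a (hs \o S) + f a (hs \o S) *: F' a hs).
split.
- move=> a hs c u v.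
  have E x : scons x hs \o S = hs by [].
  rewrite !E lf lF scalerDl scalerDr -scalerA addrACA scalerDr !scalerA.
  by rewrite (mulrC (f a hs)).
- apply: unif_derivativeZ => //; exact: smooth_fam_bounded sf'.
- apply: smooth_famD.
    exact: IH sf' (smooth_fam_reindex S (smooth_famS sF)).
  exact: IH (smooth_fam_reindex S (smooth_famS sf)) sF'.
Qed.

End products.

(** The derivative of [1 / f] is [- f' / f ^ 2], with [f] reindexed so as to ignore
the new head; it is smooth by induction on the order, as [1 / f] is at the order
below. *)
Lemma smooth_fam_inv k (f : V -> (nat -> V) -> R) : smooth_fam k f ->
  (forall r, exists2 c : R, 0 < c & forall a hs, `|a| <= r -> seq_bounded r hs ->
    c <= `|f a hs|) ->
  smooth_fam k (fun a hs => (f a hs)^-1).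
Proof.
move=> + lb; have bV : bounded_fam (fun a hs => (f a hs)^-1).
  move=> r; have [c c0 Hc] := lb r; exists c^-1; first by rewrite invr_ge0 ltW.
  move=> a hs ar hsr; rewrite normfV lef_pV2 ?posrE//; first exact: Hc.
  by rewrite (lt_le_trans c0)// Hc.
have cV : unif_continuous_fam f -> unif_continuous_fam (fun a hs => (f a hs)^-1).
  move=> cf; apply: unif_continuousC => a r; set m := Num.max r (`|a| + 1).
  have [K K0 HK] := bV m; have [c c0 Hc] := lb m.
  exists (K * K) => [|e e0]; first exact: mulr_ge0.
  apply: filterS2 (near_norm_le a) (cf a r e e0) => b ba Hf hs hsr.
  have hsr' : seq_bounded m hs by apply: seq_boundedW hsr; rewrite le_max lexx.
  have am : `|a| <= m by rewrite le_max lerDl ler01 orbT.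
  have bm : `|b| <= m by rewrite le_max ba orbT.
  have fa0 : f a hs != 0 by rewrite -normr_gt0 (lt_le_trans c0) ?Hc.
  have fb0 : f b hs != 0 by rewrite -normr_gt0 (lt_le_trans c0) ?Hc.
  have -> : (f b hs)^-1 - (f a hs)^-1 =
    - ((f b hs)^-1 * (f a hs)^-1 * (f b hs - f a hs)) by field; exact/andP.
  rewrite normrN !normrM !ler_pM//; [exact: HK|exact: HK|exact: Hf].
elim: k => [|k IH] sf.
  by case: sf => cf bf _; split=> //; exact: cV.
have [cf bf [f' [lf df sf']]] := sf.
split=> //; first exact: cV.
exists (fun a hs => (- ((f a (hs \o S))^-1 * (f a (hs \o S))^-1)) * f' a hs).
have sV : smooth_fam k (fun a hs => (f a hs)^-1) by apply: IH; exact: smooth_famS.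
split; last first.
- apply: smooth_famZ sf'.
  have -> : (fun a hs => - ((f a (hs \o S))^-1 * (f a (hs \o S))^-1)) =
    (fun a hs => (-1 : R) *: ((f a (hs \o S))^-1 *: (f a (hs \o S))^-1)).
    by apply/funext => a; apply/funext => hs; rewrite scaleN1r.
  apply: smooth_famZ; first exact: smooth_fam_cst.
  by apply: smooth_famZ; apply: (smooth_fam_reindex S sV).
- apply: unif_derivativeC => a r; set m := Num.max r (`|a| + 1).
  have [K K0 HK] := bV m; have [c c0 Hc] := lb m.
  have [K' K'0 HK'] := head_bounded lf (smooth_fam_bounded sf') m.
  exists (K * K * (K' * K + 1)) => [|e e0].
    by rewrite !mulr_ge0// addr_ge0// mulr_ge0.
  have near_a : \forall h \near (0 : V), `|a + h| <= `|a| + 1.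
    exact: near_shift0 (near_norm_le a).
  have near_f := @near_shift0 a (fun b => forall hs, _ ->
    `|f b hs - f a hs| <= e) (cf a r e e0).
  apply: filterS3 near_a near_f (df a r e e0) => h ha Hf Hd hs hsr.
  have hsr' : seq_bounded m hs by apply: seq_boundedW hsr; rewrite le_max lexx.
  have am : `|a| <= m by rewrite le_max lerDl ler01 orbT.
  have bm : `|a + h| <= m by rewrite le_max ha orbT.
  have fa0 : f a hs != 0 by rewrite -normr_gt0 (lt_le_trans c0) ?Hc.
  have fb0 : f (a + h) hs != 0 by rewrite -normr_gt0 (lt_le_trans c0) ?Hc.
  have -> : scons h hs \o S = hs by [].
  have -> : (f (a + h) hs)^-1 - (f a hs)^-1 -
      - ((f a hs)^-1 * (f a hs)^-1) * f' a (scons h hs) =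
    (f (a + h) hs)^-1 * (f a hs)^-1 *
      (f' a (scons h hs) * (f a hs)^-1 * (f (a + h) hs - f a hs) -
       (f (a + h) hs - f a hs - f' a (scons h hs))).
    by field; exact/andP.
  rewrite normrM -!mulrA (mulrA K) ler_pM//.
    by rewrite normrM ler_pM// HK.
  rewrite (le_trans (ler_normB _ _))// mulrDl mul1r lerD//; last exact: Hd.
  rewrite !normrM mulrA (mulrC e) [leRHS]mulrA ler_pM//; last exact: Hf.
  by rewrite mulrAC ler_pM// ?HK'// HK.
- move=> a hs c u v; have E x : scons x hs \o S = hs by [].
  by rewrite !E lf mulrDr [c *: f' _ _]/(c * _) mulrCA.
Qed.

End uniform_calculus.

(** * From families to iterated Frechet derivatives *)

Lemma near_center0 {R : realType} {V : normedModType R} (a : V) (P : V -> Prop) :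
  (\forall u \near (0 : V), P u) -> \forall b \near a, P (b - a).
Proof.
move=> P0; have c : (fun b => b - a) @ a --> a - a.
  by apply: cvgB; [exact: cvg_id|exact: cvg_cst].
by rewrite subrr in c; exact: c.
Qed.

Section locally_lipschitz.
Context {R : realType} {V W : normedModType R}.
Variable f : V -> W.
Hypothesis fL : forall r : R, exists2 C : R, 0 <= C &
  forall a b, `|a| <= r -> `|b| <= r -> `|f b - f a| <= C * `|b - a|.

Lemma locally_lipschitz_unif_continuous : unif_continuous_fam (fun a _ => f a).
Proof.
apply: unif_continuousC => a r; have [C C0 HC] := fL (`|a| + 1).
exists C => // e e0.
have ad : \forall b \near a, `|a - b| < e.
  by have := nbhsx_ballx a _ e0; rewrite -ball_normE.
have aa : `|a| <= `|a| + 1 by rewrite lerDl.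
apply: filterS2 ad (near_norm_le a) => b ab b1 _ _.
by rewrite (le_trans (HC a b aa b1))// ler_wpM2l// distrC ltW.
Qed.

Lemma locally_lipschitz_continuous : continuous f.
Proof.
move=> a; apply/cvgrPdist_le => e e0.
apply: filterS (locally_lipschitz_unif_continuous a 0 e0) => b H.
by rewrite distrC; apply: (H (fun=> 0)) => j; rewrite normr0.
Qed.

Lemma locally_lipschitz_bounded : bounded_fam (fun a _ => f a).
Proof.
move=> r; have [C C0 HC] := fL `|r|; exists (C * `|r| + `|f 0|).
  by rewrite addr_ge0// mulr_ge0.
move=> a _ ar _; have ar' : `|a| <= `|r| by rewrite (le_trans ar) ?ler_norm.
rewrite -[f a](subrK (f 0)) (le_trans (ler_normD _ _))// lerD2r.
have := HC 0 a; rewrite normr0 subr0 => /(_ (normr_ge0 _) ar') /le_trans; apply.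
by rewrite ler_wpM2l.
Qed.

End locally_lipschitz.

Lemma linear_le_continuous {R : realType} {V W : normedModType R}
    (f : {linear V -> W}) (K : R) :
  (forall v, `|f v| <= K * `|v|) -> continuous f.
Proof.
move=> fK; apply: bounded_linear_continuous; exists `|K|; split => // M KM.
have := near_norm_le (0 : V); rewrite normr0 add0r; apply: filterS => v v1 /=.
rewrite (le_trans (fK v))// (le_trans _ (ltW KM))//.
rewrite (le_trans (ler_wpM2r _ (ler_norm K)))//.
by rewrite ler_piMr.
Qed.

Lemma smooth_fam_linear {R : realType} {V W : normedModType R} k (f : V -> W)
    (C : R) : 0 <= C -> linear f -> (forall v, `|f v| <= C * `|v|) ->
  smooth_fam k (fun a _ => f a).
Proof.
move=> C0 lf fC.
have fB a b : f b - f a = f (b - a).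
  by have := lf (-1) a b; rewrite !scaleN1r ![- _ + _]addrC.
have lip (r : R) : exists2 C : R, 0 <= C & forall a b, `|a| <= r -> `|b| <= r ->
    `|f b - f a| <= C * `|b - a|.
  by exists C => // a b _ _; rewrite fB.
have b0 := locally_lipschitz_bounded lip.
have c0 := locally_lipschitz_unif_continuous lip.
case: k => [|k]; split=> //; exists (fun _ hs => f (hs 0%N)); split.
- by move=> a hs c u v; exact: lf.
- move=> a r e e0; apply: nearW => h hs _ /=.
  by rewrite fB addrAC subrr add0r subrr normr0 mulr_ge0// ltW.
- apply: smooth_fam_const_in_point => r; exists (C * `|r|) => [|hs hsr].
    by rewrite mulr_ge0.
  by rewrite (le_trans (fC _))// ler_wpM2l// (le_trans (hsr 0%N))// ler_norm.
Qed.

Section iterated_derivative.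
Context {R : realType} {V W : normedModType R}.

(** Only the first [n] directions matter; the others are set to 0. *)
Definition seq_of n (h : 'I_n -> V) : nat -> V :=
  fun j => if insub j is Some i then h i else 0.

Lemma seq_of_bounded n (h : 'I_n -> V) r :
  0 <= r -> (forall i, `|h i| <= r) -> seq_bounded r (seq_of h).
Proof.
by move=> r0 hr j; rewrite /seq_of; case: insubP => [i _ _|_]; rewrite ?normr0.
Qed.

Lemma seq_ofS n (h : 'I_n.+1 -> V) :
  seq_of h = scons (h ord0) (seq_of (fun j => h (lift ord0 j))).
Proof.
apply/funext => -[|j] /=; rewrite /seq_of.
  by case: insubP => // i _ i0; congr h; exact: val_inj.
case: insubP => [i _ ij|]; case: insubP => [k _ kj|].
- by congr h; apply: val_inj; rewrite /= ij -kj.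
- by rewrite -ltnS -ij ltn_ord.
- by rewrite ltnS -kj ltn_ord.
- by [].
Qed.

(** Multilinearity and continuity pass to limits that are uniform on bounded
sets of arguments. *)
Lemma approx_continuous_multilinear n (A : {ptws 'I_n -> V} -> W) :
  (forall r e : R, 0 < e -> exists G : cmultilin V W n,
     forall h : 'I_n -> V, (forall i, `|h i| <= r) -> `|G h - A h| <= e) ->
  continuous_multilinear A.
Proof.
move=> apx; split=> [h k c u v|h].
  pose r := \sum_i `|h i| + (`|c *: u + v| + `|u| + `|v|).
  have hr i : `|h i| <= \sum_i `|h i|.
    by rewrite (bigD1 i)//= lerDl sumr_ge0.
  have dr w : `|w| <= `|c *: u + v| + `|u| + `|v| ->
      forall i, `|dfwith h k w i| <= r.
    move=> wr i; have [->|ik] := eqVneq i k.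
      by rewrite dfwithin (le_trans wr)// lerDr sumr_ge0.
    by rewrite dfwithout 1?eq_sym// (le_trans (hr i))// lerDl !addr_ge0.
  apply/eqP; rewrite -subr_eq0 -normr_le0; apply/ler_addgt0Pl => e e0.
  have e'0 : 0 < e / (2 + `|c|) by rewrite divr_gt0// ltr_pwDl.
  have [G HG] := apx r _ e'0; rewrite addr0.
  have [Gl _] := cmultilinP G.
  have Hw := HG _ (dr (c *: u + v) _); have Hu := HG _ (dr u _).
  have Hv := HG _ (dr v _).
  set x := A (dfwith h k (c *: u + v)) in Hw *.
  set y := A (dfwith h k u) in Hu *; set z := A (dfwith h k v) in Hv *.
  rewrite (_ : x - (c *: y + z) = c *: (G (dfwith h k u) - y) +
      (G (dfwith h k v) - z) - (G (dfwith h k (c *: u + v)) - x)); last first.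
    by rewrite Gl scalerBr addrACA -opprD opprB [RHS]addrC addrA subrK.
  have -> : e = `|c| * (e / (2 + `|c|)) + e / (2 + `|c|) + e / (2 + `|c|).
    by field; rewrite gt_eqF// ltr_pwDl.
  rewrite (le_trans (ler_normB _ _))// lerD ?Hw//; last by rewrite -addrA lerDl addr_ge0.
  rewrite (le_trans (ler_normD _ _))// lerD//; last by rewrite Hv// lerDr addr_ge0.
  by rewrite normrZ ler_wpM2l// Hu// addrAC lerDr addr_ge0.
have Fh : Filter (nbhs h) by exact: nbhs_filter.
apply/(@cvgrPdist_le _ _ _ (nbhs h) Fh) => e e0.
have e3 : 0 < e / 3 by rewrite divr_gt0.
pose r := \sum_i `|h i| + 1.
have hr i : `|h i| + 1 <= r.
  by rewrite lerD2r (bigD1 i)//= lerDl sumr_ge0.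
have [G HG] := apx r _ e3; have [_ Gc] := cmultilinP G.
have hr' : \forall g \near h, forall i, `|g i| <= r.
  apply: (@filter_forall _ _ (fun i g => `|g i| <= r) (nbhs h) Fh) => i.
  have : (fun g : {ptws 'I_n -> V} => g i) @ h --> h i.
    exact: (@proj_continuous _ (fun=> V) i h).
  move=> /(_ _ (near_norm_le (h i))) H.
  by apply: (@filterS _ _ Fh _ _ _ H) => g /= /le_trans; exact.
have Gh : \forall g \near h, `|G h - G g| <= e / 3.
  by have /(@cvgrPdist_le _ _ _ (nbhs h) Fh)/(_ _ e3) := Gc h.
apply: (@filterS2 _ (nbhs h) Fh _ _ _ _ hr' Gh) => g gr Gg.
have -> : A h - A g = (G h - G g) + (G g - A g) - (G h - A h).
  by rewrite addrA subrK opprB [RHS]addrC addrA subrK.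
rewrite (le_trans (ler_normB _ _))//.
have -> : e = e / 3 + e / 3 + e / 3 by field.
rewrite lerD//; last by apply: HG => i; rewrite (le_trans _ (hr i))// lerDl.
by rewrite (le_trans (ler_normD _ _))// lerD// HG.
Qed.

(** If a map [g] into multilinear maps is given by a family [F], its
differential is given by the derived family [F']. That [F'] is multilinear and
continuous in the remaining directions need not be assumed: it is a limit of
difference quotients of [g], uniformly on bounded sets of directions. *)
Section step.
Variables (n : nat) (g : V -> cmultilin V W n) (F F' : V -> (nat -> V) -> W).
Hypothesis gF : forall a (h : 'I_n -> V), g a h = F a (seq_of h).
Hypotheses (lF' : head_linear F') (bF' : bounded_fam F').
Hypothesis dF : unif_derivative F F'.

Let slice a (h : V) : {ptws 'I_n -> V} -> W := fun hs => F' a (scons h (seq_of hs)).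

Lemma slice_multilinear a h : continuous_multilinear (slice a h).
Proof.
apply: approx_continuous_multilinear => r e e0.
have e'0 : 0 < e / (`|h| + 1) by rewrite divr_gt0// ltr_wpDl.
have c : (fun t : R => t *: h) @ (0 : R) --> 0 *: h.
  by apply: cvgZr_tmp; exact: cvg_id.
rewrite scale0r in c.
have := c _ (dF a (Num.max r 0) e'0) => /nbhs_ballP[d /= d0 Hd].
(* The approximant is the difference quotient of [g] at this step. *)
pose t := d / 2.
have t0 : 0 < t by rewrite divr_gt0.
have /Hd Ht : ball (0 : R) d t.
  by rewrite -ball_normE /= sub0r normrN gtr0_norm// ltr_pdivrMr// ltr_pMr// ltr1n.
exists (t^-1 *: (g (a + t *: h) - g a)) => hs hsr.
have hsr' : seq_bounded (Num.max r 0) (seq_of hs).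
  by apply: seq_of_bounded; [|move=> i]; rewrite le_max ?lexx ?orbT ?hsr.
have := Ht _ hsr'; rewrite /= head_linearZ// normrZ gtr0_norm// => H.
rewrite -[X in `|X|](_ : t^-1 *: (F (a + t *: h) (seq_of hs) - F a (seq_of hs)
  - t *: F' a (scons h (seq_of hs))) = _); last first.
  by rewrite scalerBr scalerA mulVf ?gt_eqF// scale1r -!gF.
rewrite normrZ gtr0_norm ?invr_gt0// mulrC ler_pdivrMr//.
rewrite (le_trans H)// mulrCA mulrC ler_pM2r//.
by rewrite mulrAC ler_pdivrMr ?ltr_wpDl// ler_wpM2l ?(ltW e0)// lerDl.
Qed.

Let slice_cm a h : cmultilin V W n := cmultilin_of (slice a h).

Let slice_cmE a h (hs : 'I_n -> V) : slice_cm a h hs = F' a (scons h (seq_of hs)).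
Proof. by rewrite /slice_cm cmultilin_ofE//; exact: slice_multilinear. Qed.

Let slice_linear a : linear (slice_cm a).
Proof.
move=> c u v; apply/val_inj/funext => hs.
by rewrite -[RHS]/(c *: slice_cm a u hs + slice_cm a v hs) /= !slice_cmE lF'.
Qed.

Let slice_lin a : {linear V -> cmultilin V W n} :=
  HB.pack (slice_cm a) (GRing.isLinear.Build R V _ *:%R (slice_cm a) (@slice_linear a)).

Lemma slice_lin_continuous a : continuous (slice_lin a).
Proof.
have [K K0 HK] := head_bounded lF' bF' (Num.max `|a| 1).
apply: (@linear_le_continuous _ _ _ _ K) => v.
apply: opnorm_le => hs hs1; rewrite [slice_lin a v hs]slice_cmE; apply: HK.
  by rewrite le_max lexx.
by apply: seq_of_bounded => [|i]; rewrite le_max ?ler01 ?orbT// hs1 orbT.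
Qed.

Lemma nderiv_step a : differentiable g a /\
  forall h (hs : 'I_n -> V), 'd g a h hs = F' a (scons h (seq_of hs)).
Proof.
have dg : g \o shift a = cst (g a) + slice_lin a +o_ (0 : V) id.
  apply/eqaddoP => e e0; apply: filterS (dF a 1 e0) => h H.
  apply: opnorm_le => hs hs1.
  rewrite [X in `|X|](_ : _ = F (a + h) (seq_of hs) - F a (seq_of hs) -
    F' a (scons h (seq_of hs))); last first.
    rewrite -slice_cmE -!gF (addrC a) -addrA -opprD.
    by [].
  exact/H/seq_of_bounded.
have dE := diff_unique (@slice_lin_continuous a) dg.
split; last by move=> h hs; rewrite dE [LHS]slice_cmE.
apply/diff_locallyP; rewrite dE; split=> //; exact: slice_lin_continuous.
Qed.

End step.

(** The families [Fj] are the successive derivatives of [F]. *)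
Lemma nderiv_smooth_fam n (f : V -> W) (F : V -> (nat -> V) -> W) :
  (forall a hs, F a hs = f a) -> smooth_fam n F ->
  forall j, (j <= n)%N -> exists Fj, smooth_fam (n - j) Fj /\
    forall a (h : 'I_j -> V), nderiv f j a h = Fj a (seq_of h).
Proof.
move=> Ff sF; elim=> [_|j IH jn].
  by exists F; split; [rewrite subn0|move=> a h; rewrite nderiv0E Ff].
have [Fj [+ E]] := IH (ltnW jn).
rewrite -(subnSK jn) => -[_ _ [F' [lF' dF sF']]].
exists F'; split=> // a h.
have [dj Hj] := nderiv_step E lF' (smooth_fam_bounded sF') dF a.
by rewrite nderivSE// Hj seq_ofS.
Qed.

Lemma smooth_fam_class_C n (f : V -> W) (F : V -> (nat -> V) -> W) :
  (forall a hs, F a hs = f a) -> smooth_fam n F -> class_C n f.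
Proof.
move=> Ff sF; split.
  move=> j jn a; have [Fj [+ E]] := nderiv_smooth_fam Ff sF (ltnW jn).
  rewrite -(subnSK jn) => -[_ _ [F' [lF' dF sF']]].
  by have [] := nderiv_step E lF' (smooth_fam_bounded sF') dF a.
have [Fn [/smooth_fam_cont cF E]] := nderiv_smooth_fam Ff sF (leqnn n).
move=> a; apply/cvgrPdist_le => e e0.
apply: filterS (cF a 1 e e0) => b Hb.
rewrite -normrN opprB; apply: opnorm_le => h h1.
rewrite [X in `|X|](_ : _ = Fn b (seq_of h) - Fn a (seq_of h)); last first.
  by rewrite -!E.
exact/Hb/seq_of_bounded.
Qed.

Lemma smooth_fam_nderiv_bounded n (f : V -> W) (F : V -> (nat -> V) -> W) :
  (forall a hs, F a hs = f a) -> smooth_fam n F ->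
  forall j, (j <= n)%N -> forall r : R, exists2 K : R, 0 <= K &
    forall a, `|a| <= r -> `|nderiv f j a| <= K.
Proof.
move=> Ff sF j jn r.
have [Fj [/smooth_fam_bounded bF E]] := nderiv_smooth_fam Ff sF jn.
have [K K0 HK] := bF (Num.max r 1); exists K => // a ar.
apply: opnorm_le => h h1; rewrite E; apply: HK; first by rewrite le_max ar.
by apply: seq_of_bounded => [|i]; rewrite le_max ?ler01 ?orbT// h1 orbT.
Qed.

Lemma smooth_fam_nderiv_sum_bounded n (f : V -> W) :
  smooth_fam n (fun a _ => f a) -> forall r : R, exists K : R,
    forall a, `|a| <= r ->
      `|f a| + \sum_(1 <= j < n.+1) `|nderiv f j a| <= K.
Proof.
move=> sf r; suff H m : (m <= n)%N -> exists K : R, forall a, `|a| <= r ->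
    `|f a| + \sum_(1 <= j < m.+1) `|nderiv f j a| <= K by exact: H.
elim: m => [_|m IH mn].
  have [K _ HK] := smooth_fam_bounded sf `|r|; exists K => a ar.
  rewrite big_geq// addr0; apply: (HK _ (fun=> 0)).
    by rewrite (le_trans ar) ?ler_norm.
  by move=> j; rewrite normr0.
have [K HK] := IH (ltnW mn).
have [L _ HL] := smooth_fam_nderiv_bounded (fun a _ => erefl) sf mn r.
exists (K + L) => a ar; rewrite big_nat_recr//= addrA.
by rewrite lerD ?HK ?HL.
Qed.

Lemma smooth_fam_differentiable (f : V -> W) a :
  smooth_fam 1 (fun a _ => f a) -> differentiable f a.
Proof.
case=> _ _ [F' [lF' dF [_ bF' _]]].
pose l h := F' a (scons h (fun=> 0)).
have ll : linear l by move=> c u v; exact: lF'.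
pose L : {linear V -> W} := HB.pack l (GRing.isLinear.Build R V W *:%R l ll).
have z0 r : 0 <= r -> seq_bounded r (fun=> 0 : V) by move=> r0 j; rewrite normr0.
have Lc : continuous L.
  have [K K0 HK] := head_bounded lF' bF' `|a|.
  by apply: (@linear_le_continuous _ _ _ _ K) => v; apply: HK => //; exact: z0.
have df : f \o shift a = cst (f a) + L +o_ (0 : V) id.
  apply/eqaddoP => e e0; apply: filterS (dF a 1 e e0) => h H.
  have := H _ (z0 1 ler01); rewrite (addrC a) -addrA -opprD; exact.
by apply/diff_locallyP; rewrite (diff_unique Lc df).
Qed.

(** A continuous linear left inverse [c] of [f] differentiates to a left inverse
of ['d f a], whose range is then complemented by the kernel of [c]. *)
Lemma left_inverse_immersion n (f : V -> W) (c : {linear W -> V}) :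
  class_C n f -> (forall a, differentiable f a) -> continuous c ->
  cancel f c -> immersion n f.
Proof.
move=> fC df cc fK; split=> // a.
have cd h : c ('d f a h) = h.
  have := diff_comp (df a) (linear_differentiable (f a) cc).
  rewrite (diff_lin (f a) cc) (_ : c \o f = id); last exact/funext.
  by move=> /(congr1 (@^~ h)) /= <-; rewrite diff_val.
split; first by move=> u v uv; rewrite -(cd u) uv cd.
have rangeE : range ('d f a) = [set w | w - 'd f a (c w) = 0].
  apply/seteqP; split=> [_ [h _ <-]|w /= /subr0_eq ->]; last by exists (c w).
  by rewrite /= cd subrr.
have closed0 (U : normedModType R) (g : W -> U) :
    continuous g -> closed [set w | g w = 0].
  move=> gc; apply: (@closed_comp _ _ g [set 0]) => [w _|]; first exact: gc.
  exact/accessible_closed_set1/hausdorff_accessible/norm_hausdorff.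
split.
  rewrite rangeE; apply: closed0 => w; apply: cvgB; first exact: cvg_id.
  by apply: cvg_comp; [exact: cc|exact: diff_continuous].
exists [set w | c w = 0]; split.
- by split=> [|e u v /= u0 v0]; rewrite /= ?linear0// linearP u0 v0 scaler0 addr0.
- exact: closed0.
- apply/seteqP; split=> [w [[h _ <-]] /=|w /= ->].
    by rewrite cd => ->; rewrite linear0.
  by split; [exists 0 => //; rewrite linear0|rewrite /= linear0].
- move=> w; exists ('d f a (c w)), (w - 'd f a (c w)); split.
  + by exists (c w).
  + by rewrite /= linearB /= cd subrr.
  + by rewrite addrC subrK.
Qed.

End iterated_derivative.

(** * The balanced chart on the real line *)

Section balanced_chart.
Context {R : realType}.
Implicit Types (x y u v : R) (P : {poly R}).

(** The chart as a function of [u = ln p], which turns its domain into the whole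
line. *)
Definition balance u : R := expR u - 1 + u.

Lemma balance_derive u : is_derive u 1 balance (expR u + 1).
Proof.
have d : is_derive u (1 : R) (expR + cst (- 1) + id) (expR u + 0 + 1).
  by apply: is_deriveD.
by rewrite addr0 in d.
Qed.

Lemma ltr_balance : {mono balance : u v / u < v}.
Proof.
apply: leW_mono; apply: le_mono => u v uv.
by rewrite /balance ltrD// ltrD2r ltr_expR.
Qed.

Lemma balance_inj : injective balance.
Proof. by apply: inc_inj; apply: le_mono => u v; rewrite ltr_balance. Qed.

Lemma balance_surj x : exists u, balance u = x.
Proof.
have x0 : - `|x| <= `|x| by rewrite (le_trans _ (normr_ge0 x))// oppr_le0.
have cb : {within `[- `|x|, `|x|], continuous balance}.
  apply: derivable_within_continuous => u _.
  exact: (@ex_derive _ _ _ _ _ _ _ (balance_derive u)).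
have [|c _ cx] := IVT (v := x) x0 cb; last by exists c.
rewrite ge_min le_max; apply/andP; split; apply/orP; [left|right].
  rewrite /balance (le_trans _ (lerNnormlW (lexx `|x|)))// gerDr subr_le0 -[leRHS]expR0.
  by rewrite ler_expR oppr_le0.
rewrite /balance (le_trans (ler_norm x))// lerDr subr_ge0 -[leLHS]expR0.
by rewrite ler_expR.
Qed.

Definition logdens x : R := sval (cid (balance_surj x)).

Lemma logdensK : cancel logdens balance.
Proof. by move=> x; rewrite /logdens; case: cid. Qed.

Lemma balanceK : cancel balance logdens.
Proof. by move=> u; apply: balance_inj; rewrite logdensK. Qed.

Definition dens x : R := expR (logdens x).

Lemma dens_gt0 x : 0 < dens x. Proof. exact: expR_gt0. Qed.

Lemma dens_balance x : dens x - 1 + logdens x = x.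
Proof. exact: logdensK. Qed.

Lemma ln_dens x : ln (dens x) = logdens x. Proof. exact: expRK. Qed.

Lemma logdens_ln y : 0 < y -> logdens (y - 1 + ln y) = ln y.
Proof. by move=> y0; rewrite -[RHS]balanceK /balance lnK. Qed.

Lemma dens0 : dens 0 = 1.
Proof.
have := logdens_ln ltr01; rewrite ln1 subrr addr0 /dens => ->.
exact: expR0.
Qed.

Lemma normr_logdens_le x : `|logdens x| <= `|x|.
Proof.
rewrite -{2}(logdensK x) /balance; set u := logdens x.
have [u0|u0] := leP 0 u.
  have e0 : 0 <= expR u - 1 by rewrite subr_ge0 -[leLHS]expR0 ler_expR.
  by rewrite !ger0_norm; lra.
have e0 : expR u - 1 <= 0 by rewrite subr_le0 -[leRHS]expR0 ler_expR ltW.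
by rewrite !ler0_norm; lra.
Qed.

Lemma dens_le x : dens x <= 1 + `|x|.
Proof.
have [u0|u0] := leP 0 (logdens x).
  rewrite -[leLHS](subrK 1) addrC lerD2l (le_trans _ (ler_norm x))//.
  by rewrite -{2}(dens_balance x) lerDl.
rewrite (@le_trans _ _ 1) ?lerDl// /dens -[leRHS]expR0 ler_expR ltW//.
Qed.

(** The derivative of [logdens], by the inverse function theorem. It lies in
[(0, 1)] and is the variable in which derivatives of all orders of [dens] are
polynomials. *)
Definition dlogdens x : R := (1 + dens x)^-1.

Lemma dens1_gt0 x : 0 < 1 + dens x.
Proof. by rewrite addr_gt0 ?dens_gt0. Qed.

Lemma dlogdens_gt0 x : 0 < dlogdens x.
Proof. by rewrite invr_gt0 dens1_gt0. Qed.

Lemma dlogdens_le1 x : dlogdens x <= 1.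
Proof. by rewrite invf_le1 ?dens1_gt0// lerDl ltW ?dens_gt0. Qed.

Lemma dens_dlogdens x : dens x * dlogdens x = 1 - dlogdens x.
Proof.
by rewrite /dlogdens; field; rewrite gt_eqF// dens1_gt0.
Qed.

Lemma logdens_derive x : is_derive x 1 logdens (dlogdens x).
Proof.
rewrite -[x in is_derive x]logdensK /dlogdens addrC.
apply: (@is_derive_inverse R balance).
- by near=> u; exact: balanceK.
- near=> u; apply/differentiable_continuous/derivable1_diffP.
  exact: (@ex_derive _ _ _ _ _ _ _ (balance_derive u)).
- exact: balance_derive.
- by rewrite gt_eqF// addrC dens1_gt0.
Unshelve. all: by end_near. Qed.

Lemma dens_derive x : is_derive x 1 dens (1 - dlogdens x).
Proof.
rewrite -dens_dlogdens.
exact: is_derive1_comp (is_derive_expR _) (logdens_derive x).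
Qed.

Lemma dlogdens_derive x :
  is_derive x 1 dlogdens (- dlogdens x ^+ 2 * (1 - dlogdens x)).
Proof.
have d : is_derive x (1 : R) (cst 1 + dens) (0 + (1 - dlogdens x)).
  by apply: is_deriveD; exact: dens_derive.
have n0 : (cst 1 + dens) x != 0 by rewrite gt_eqF// dens1_gt0.
have := is_deriveV n0 d; rewrite add0r => dV.
by apply: (is_derive_eq dV); rewrite /dlogdens exprVn.
Qed.

(** The derivation that differentiation in [x] induces on polynomials in
[q = dlogdens x], since [q' = - q ^ 2 * (1 - q)]. *)
Definition dstep P : {poly R} := - P^`() * 'X^2 * (1 - 'X).

Definition dpoly P x : R := P.[dlogdens x].

Lemma dpoly_derive P x : is_derive x 1 (dpoly P) (dpoly (dstep P) x).
Proof.
have d := is_derive1_comp (is_derive_poly P (dlogdens x)) (dlogdens_derive x).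
apply: (is_derive_eq d).
by rewrite /dpoly /dstep !(hornerM, hornerN, hornerXn, hornerD, hornerC, hornerX); ring.
Qed.

Lemma dpoly_bounded P : exists2 M : R, 0 <= M & forall x, `|dpoly P x| <= M.
Proof.
exists (\sum_(i < size P) `|P`_i|) => [|x]; first by rewrite sumr_ge0.
rewrite /dpoly horner_coef (le_trans (ler_norm_sum _ _ _))// ler_sum// => i _.
rewrite normrM ler_piMr// normrX exprn_ile1// ger0_norm ?(ltW (dlogdens_gt0 x))//.
exact: dlogdens_le1.
Qed.

Lemma mean_value (f f' : R -> R) x u : (forall y, is_derive y 1 f (f' y)) ->
  exists2 y, `|y - x| <= `|u| & f (x + u) - f x = f' y * u.
Proof.
move=> df.
have cf (a b : R) : {within `[a, b], continuous f}.
  apply: derivable_within_continuous => z _.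
  exact: (@ex_derive _ _ _ _ _ _ _ (df z)).
have [u0|u0] := leP 0 u.
  have [|c] := @MVT_segment R f f' x (x + u) _ (fun z _ => df z) (cf _ _).
    by rewrite lerDl.
  rewrite in_itv /= => /andP[xc cxu] E; exists c; last by rewrite E; ring.
  by rewrite !ger0_norm ?subr_ge0// lerBlDl.
have [|c] := @MVT_segment R f f' (x + u) x _ (fun z _ => df z) (cf _ _).
  by rewrite gerDl ltW.
rewrite in_itv /= => /andP[xc cxu] E; exists c; last first.
  by rewrite -opprB E; ring.
rewrite ler0_norm ?subr_le0// ltr0_norm// opprB lerBlDl -lerBlDr opprK.
exact: xc.
Qed.

Lemma dpoly_lipschitz P : exists2 M : R, 0 <= M &
  forall x u, `|dpoly P (x + u) - dpoly P x| <= M * `|u|.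
Proof.
have [M M0 HM] := dpoly_bounded (dstep P); exists M => // x u.
have [y _ ->] := mean_value x u (dpoly_derive P).
by rewrite normrM ler_wpM2r.
Qed.

(** First-order remainder of a function whose derivative is some [dpoly Q]: a
truncated bound, linear in [u] for large [u] and quadratic for small [u]. *)
Lemma taylor1_dpoly (f : R -> R) Q :
  (forall x, is_derive x 1 f (dpoly Q x)) ->
  exists2 M : R, 0 <= M & forall x u,
    `|f (x + u) - f x - dpoly Q x * u| <= Num.min M (M * `|u|) * `|u|.
Proof.
move=> df.
have [K K0 HK] := dpoly_bounded Q; have [L L0 HL] := dpoly_lipschitz Q.
exists (2 * K + L) => [|x u]; first by rewrite addr_ge0// mulr_ge0.
have [y xy E] := mean_value x u df.
rewrite E -mulrBl normrM ler_wpM2r// le_min; apply/andP; split.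
  rewrite (le_trans (ler_normB _ _))// (@le_trans _ _ (K + K))//.
    by rewrite lerD.
  by lra.
have := HL x (y - x); rewrite (addrC x) subrK => /le_trans; apply.
by rewrite mulrDl (le_trans (ler_wpM2l L0 xy))// lerDr !mulr_ge0.
Qed.

Lemma derive_measurable (f f' : R -> R) : (forall x, is_derive x 1 f (f' x)) ->
  measurable_fun [set: R] f.
Proof.
move=> df; apply: continuous_measurable_fun => x.
apply/differentiable_continuous/derivable1_diffP.
exact: (@ex_derive _ _ _ _ _ _ _ (df x)).
Qed.

(** The polynomial in [dlogdens] that gives the derivative of [dens]. *)
Definition dens_slope : {poly R} := 1 - 'X.

Lemma dpoly_dens_slope x : dpoly dens_slope x = 1 - dlogdens x.
Proof. by rewrite /dpoly !hornerE. Qed.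

(** In terms of [u = logdens x] and [v = logdens y], the convexity of [dens] is that
of the exponential: [expR v - expR u >= expR u * (v - u)]. *)
Lemma dens_tangent x y :
  dens x + (1 - dlogdens x) * (y - x) <= dens y.
Proof.
set u := logdens x; set v := logdens y.
have H : expR u * (1 + (v - u)) <= expR v.
  by rewrite -[in leRHS](subrK u v) expRD mulrC ler_wpM2r ?expR_ge0// expR_ge1Dx.
rewrite -lerBrDl -dens_dlogdens -(ler_pM2r (dens1_gt0 x)).
have -> : dens x * dlogdens x * (y - x) * (1 + dens x) = dens x * (y - x).
  by rewrite /dlogdens; field; rewrite gt_eqF// dens1_gt0.
have -> : y - x = (dens y - 1 + v) - (dens x - 1 + u) by rewrite !dens_balance.
rewrite -[expR u]/(dens x) -[expR v]/(dens y) in H.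
by nra.
Qed.

(** All factors are bounded by the largest one, say [y], and [y ^ n] is at most
[e * y ^ l] for large [y] because [n < l]. *)
Lemma prod_le_sum_powR (l : R) n e : n%:R < l -> 0 < e -> exists2 K : R, 0 <= K &
  forall x : nat -> R, (forall j, 0 <= x j) ->
    \prod_(j < n) x j <= K + e * \sum_(j < n) x j `^ l.
Proof.
move=> nl e0; case: n nl => [|n] nl.
  by exists 1 => // x _; rewrite !big_ord0 mulr0 addr0.
set s := l - n.+1%:R; have s0 : 0 < s by rewrite subr_gt0.
(* From [t] on, [y ^ n <= e * y ^ l]. *)
pose t := e^-1 `^ s^-1.
have t0 : 0 < t by rewrite powR_gt0 ?invr_gt0.
have ts : t `^ s = e^-1 by rewrite -powRrM mulVf ?gt_eqF// powRr1 ?invr_ge0 ?ltW.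
exists (t ^+ n.+1) => [|x x0]; first by rewrite exprn_ge0 ?ltW.
have [j _ Hj] := @Order.TotalTheory.arg_maxP _ _ _ ord0 xpredT (fun j : 'I_n.+1 => x j) isT.
have le_pow : \prod_(i < n.+1) x i <= x j ^+ n.+1.
  rewrite -[X in _ <= _ ^+ X](card_ord n.+1) -prodr_const ler_prod// => i _.
  by rewrite x0; exact: Hj.
have [xt|tx] := leP (x j) t.
  rewrite (le_trans le_pow)// (@le_trans _ _ (t ^+ n.+1))//.
    by rewrite lerXn2r// ?nnegrE ?x0// ltW.
  by rewrite lerDl mulr_ge0 ?(ltW e0)// sumr_ge0// => i _; exact: powR_ge0.
have xj0 : 0 < x j by exact: lt_trans tx.
rewrite (le_trans le_pow)// (@le_trans _ _ (e * x j `^ l))//.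
  have -> : x j `^ l = x j ^+ n.+1 * x j `^ s.
    rewrite -(powR_mulrn n.+1 (ltW xj0)) -powRD; last by rewrite (gt_eqF xj0) implybT.
    by rewrite /s addrC subrK.
  rewrite mulrCA ler_peMr ?exprn_ge0 ?(ltW xj0)//.
  rewrite -ler_pdivrMl// mulr1 -ts.
  by apply: ge0_ler_powR; rewrite ?nnegrE ltW.
rewrite ler_wpDl ?exprn_ge0 ?(ltW t0)// ler_wpM2l ?(ltW e0)//.
by rewrite (bigD1 j)//= lerDl sumr_ge0// => i _; exact: powR_ge0.
Qed.

End balanced_chart.

(** * Means of real functions *)

Section mean.
Context d (T : measurableType d) (R : realType) (mu : probability T R).
Implicit Types f g : T -> R.

Definition intg f := mu.-integrable [set: T] (EFin \o f).

Definition Ex f : R := \int[mu]_x f x.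

Lemma intg_measurable f : intg f -> measurable_fun [set: T] f.
Proof. by move=> /measurable_int/measurable_EFinP. Qed.

Lemma intg_cst c : intg (cst c).
Proof. exact: finite_measure_integrable_cst. Qed.

Lemma intgD f g : intg f -> intg g -> intg (fun x => f x + g x).
Proof. exact: integrableD. Qed.

Lemma intgZ c f : intg f -> intg (fun x => c * f x).
Proof. exact: integrableZl. Qed.

Lemma intgB f g : intg f -> intg g -> intg (fun x => f x - g x).
Proof. exact: integrableB. Qed.

Lemma intg_sum n (f : nat -> T -> R) : (forall j, intg (f j)) ->
  intg (fun x => \sum_(j < n) f j x).
Proof.
move=> If; have := integrable_sum measurableT (index_enum 'I_n) (fun j _ => If (nat_of_ord j)).
by rewrite /intg /comp; under [X in _ -> mu.-integrable _ X]eq_fun do rewrite -sumEFin.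
Qed.

Lemma intg_le f g : measurable_fun [set: T] f -> intg g ->
  (forall x, `|f x| <= g x) -> intg f.
Proof.
move=> mf Ig fg; apply: (le_integrable measurableT _ _ Ig).
  exact/measurable_EFinP.
by move=> x _ /=; rewrite lee_fin (le_trans (fg x))// ler_norm.
Qed.

Lemma intg_norm f : intg f -> intg (fun x => `|f x|).
Proof.
move=> If; apply: (le_integrable measurableT _ _ If).
  by apply/measurable_EFinP; apply: measurableT_comp => //; exact: intg_measurable.
by move=> x _ /=; rewrite normr_id.
Qed.

Lemma Ex_cst c : Ex (cst c) = c.
Proof. by rewrite /Ex Rintegral_cst//= probability_setT mulr1. Qed.

Lemma ExD f g : intg f -> intg g -> Ex (fun x => f x + g x) = Ex f + Ex g.
Proof. exact: RintegralD. Qed.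

Lemma ExB f g : intg f -> intg g -> Ex (fun x => f x - g x) = Ex f - Ex g.
Proof. exact: RintegralB. Qed.

Lemma ExZ c f : intg f -> Ex (fun x => c * f x) = c * Ex f.
Proof. by move=> If; exact: RintegralZl. Qed.

Lemma Ex_sum n (f : nat -> T -> R) : (forall j, intg (f j)) ->
  Ex (fun x => \sum_(j < n) f j x) = \sum_(j < n) Ex (f j).
Proof.
move=> If; elim: n => [|n IH].
  by rewrite big_ord0 -[RHS](Ex_cst 0); congr Ex; apply/funext => x; rewrite big_ord0.
rewrite big_ord_recr /= -IH -ExD//; last exact: intg_sum.
by congr Ex; apply/funext => x; rewrite big_ord_recr.
Qed.

Lemma Ex_ge0 f : (forall x, 0 <= f x) -> 0 <= Ex f.
Proof. by move=> f0; apply: Rintegral_ge0. Qed.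

Lemma Ex_le f g : intg f -> intg g -> (forall x, f x <= g x) -> Ex f <= Ex g.
Proof. by move=> If Ig fg; apply: le_Rintegral. Qed.

Lemma Ex_normr_le f : intg f -> `|Ex f| <= Ex (fun x => `|f x|).
Proof. exact: le_normr_Rintegral. Qed.

Lemma Ex_ae_eq f g : measurable_fun [set: T] f -> measurable_fun [set: T] g ->
  f = g %[ae mu] -> Ex f = Ex g.
Proof.
move=> mf mg fg; congr fine; apply: ae_eq_integral => //;
  [exact/measurable_EFinP|exact/measurable_EFinP|].
by apply: filterS fg => x /(_ I) -> _.
Qed.

Lemma intg_ae_eq f g : measurable_fun [set: T] g ->
  f = g %[ae mu] -> intg f -> intg g.
Proof.
move=> mg fg /integrableP[mf If]; apply/integrableP.
split; first exact/measurable_EFinP.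
suff <- : (\int[mu]_x `|(EFin \o f) x| = \int[mu]_x `|(EFin \o g) x|)%E by [].
apply: ae_eq_integral => //.
- by apply: measurableT_comp.
- by apply: measurableT_comp => //; exact/measurable_EFinP.
- by apply: filterS fg => x /(_ I) /= -> _.
Qed.

Lemma Ex_ae_le f g : intg f -> intg g ->
  {ae mu, forall x, f x <= g x} -> Ex f <= Ex g.
Proof.
move=> If Ig fg; rewrite -subr_ge0 -ExB//.
have mf := intg_measurable If; have mg := intg_measurable Ig.
rewrite (@Ex_ae_eq _ (fun x => `|g x - f x|)).
- exact: Ex_ge0.
- exact: measurable_funB.
- by apply: measurableT_comp => //; exact: measurable_funB.
- by apply: filterS fg => x fgx _; rewrite ger0_norm// subr_ge0.
Qed.

End mean.

(** * Means of products in Lebesgue spaces *)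

Section Lspace_estimates.
Context d (T : measurableType d) (R : realType) (mu : probability T R).
Variables (l : R) (l1 : (1 <= l%:E)%E).
Local Notation Ls := (LspaceType mu l1).
Local Notation Ex := (Ex mu).
Local Notation intg := (intg mu).
Implicit Types (a b h u v : Ls) (hs : nat -> Ls).

Lemma exponent_ge1 : 1 <= l. Proof. by rewrite -lee_fin. Qed.

Lemma exponent_gt0 : 0 < l. Proof. exact: lt_le_trans exponent_ge1. Qed.

Lemma Lspace_measurable a : measurable_fun [set: T] (a : T -> R).
Proof. exact: Lfun_measurable (Lspace_Lfun a). Qed.

Lemma intg_powR a : intg (fun x => `|a x| `^ l).
Proof. exact: Lfun_integrable exponent_ge1 (Lspace_Lfun a). Qed.

Lemma Ex_powR a : Ex (fun x => `|a x| `^ l) = `|a| `^ l.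
Proof.
rewrite Lspace_normE -fine_poweR powR_Lnorm ?gt_eqF ?exponent_gt0//.
Qed.

Lemma Ex_powR_le a r : `|a| <= r -> Ex (fun x => `|a x| `^ l) <= r `^ l.
Proof.
move=> ar; rewrite Ex_powR ge0_ler_powR ?nnegrE ?(ltW exponent_gt0)//.
exact: le_trans ar.
Qed.

(** Reduces first moments to moments of order [l] without Hoelder's inequality;
the constant 2 in [Ex_norm_le] is the price. *)
Lemma powR_dominates (y : R) : 0 <= y -> y <= 1 + y `^ l.
Proof.
move=> y0; have [y1|y1] := leP y 1; first by rewrite ler_wpDr ?powR_ge0.
rewrite ler_wpDl// -[leLHS]powRr1// ler_powR ?exponent_ge1//.
exact: ltW.
Qed.

Lemma Lspace_intg a : intg a.
Proof.
apply: (@intg_le _ _ _ _ _ (fun x => 1 + `|a x| `^ l)).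
- exact: Lspace_measurable.
- by apply: intgD; [exact: intg_cst|exact: intg_powR].
- by move=> x; exact: powR_dominates.
Qed.

Lemma Ex_norm_le a : Ex (fun x => `|a x|) <= 2 * `|a|.
Proof.
have [->|a0] := eqVneq a 0.
  rewrite normr0 mulr0 (@Ex_ae_eq _ _ _ _ _ (cst 0)) ?Ex_cst//.
    by apply: measurableT_comp => //; exact: Lspace_measurable.
  by apply: filterS (Lspace0_ae mu l1) => x /(_ I) -> _; rewrite normr0.
have t0 : 0 < `|a| by rewrite normr_gt0.
have Ia := intg_norm (Lspace_intg a).
rewrite -ler_pdivrMr// mulrC -ExZ//.
have -> : 2 = Ex (fun x => 1 + (`|a| `^ l)^-1 * (`|a x| `^ l)).
  rewrite ExD; [|exact: intg_cst|by apply: intgZ; exact: intg_powR].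
  rewrite Ex_cst ExZ; last exact: intg_powR.
  by rewrite Ex_powR mulVf ?gt_eqF ?powR_gt0.
apply: Ex_le => [||x].
- exact: intgZ.
- apply: intgD; first exact: intg_cst.
  by apply: intgZ; exact: intg_powR.
- rewrite mulrC (le_trans (powR_dominates _)) ?divr_ge0//.
  have tl0 : `|a| `^ l != 0 by rewrite gt_eqF// powR_gt0.
  rewrite lerD2l -(ler_pM2l (powR_gt0 l t0)) mulrA divff// mul1r.
  by rewrite -powRM ?divr_ge0// mulrCA divff ?mulr1// gt_eqF.
Qed.

Lemma measurable_prod_norm n hs :
  measurable_fun [set: T] (fun x => \prod_(j < n) `|hs j x|).
Proof.
by apply: measurable_prod => j _; exact: measurableT_comp.
Qed.

Lemma intg_prod n hs : n%:R < l -> intg (fun x => \prod_(j < n) `|hs j x|).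
Proof.
move=> nl; have [K K0 HK] := prod_le_sum_powR nl ltr01.
apply: (@intg_le _ _ _ _ _ (fun x => K + 1 * \sum_(j < n) `|hs j x| `^ l)).
- exact: measurable_prod_norm.
- apply: intgD; first exact: intg_cst.
  apply: intgZ; apply: (@intg_sum _ _ _ _ n (fun j x => `|hs j x| `^ l)) => j.
  exact: intg_powR.
- move=> x; rewrite ger0_norm ?prodr_ge0//.
  exact: (HK (fun j => `|hs j x|)).
Qed.

Lemma intg_weight_prod n hs (w : T -> R) M : n%:R < l ->
  measurable_fun [set: T] w -> (forall x, 0 <= w x <= M) ->
  intg (fun x => w x * \prod_(j < n) `|hs j x|).
Proof.
move=> nl mw wM.
apply: (@intg_le _ _ _ _ _ (fun x => M * \prod_(j < n) `|hs j x|)).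
- by apply: measurable_funM => //; exact: measurable_prod_norm.
- by apply: intgZ; exact: intg_prod.
- move=> x; have /andP[w0 wM'] := wM x.
  by rewrite normrM !ger0_norm ?prodr_ge0// ler_wpM2r// prodr_ge0.
Qed.

Lemma intg_bounded_prod n hs (w : T -> R) M : n%:R < l ->
  measurable_fun [set: T] w -> (forall x, `|w x| <= M) ->
  intg (fun x => w x * \prod_(j < n) hs j x).
Proof.
move=> nl mw wM.
apply: (@intg_le _ _ _ _ _ (fun x => M * \prod_(j < n) `|hs j x|)).
- apply: measurable_funM => //; apply: measurable_prod => j _.
  exact: Lspace_measurable.
- by apply: intgZ; exact: intg_prod.
- by move=> x; rewrite normrM normr_prod ler_wpM2r// prodr_ge0.
Qed.

(** Uniform integrability of products of fewer than [l] functions from a ball: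
a bounded weight of small mean makes the weighted mean of such products small. *)
Lemma Ex_weight_prod n (r e M : R) : n%:R < l -> 0 < e -> 0 <= M ->
  exists2 K : R, 0 <= K & forall (w : T -> R) hs,
    measurable_fun [set: T] w -> (forall x, 0 <= w x <= M) ->
    seq_bounded r hs ->
    Ex (fun x => w x * \prod_(j < n) `|hs j x|) <= K * Ex w + e.
Proof.
move=> nl e0 M0.
(* [n%:R * r `^ l] bounds the mean of [\sum_(j < n) `|hs j x| `^ l]. *)
pose c := M * (n%:R * r `^ l) + 1.
have c0 : 0 < c by rewrite ltr_wpDl// mulr_ge0// mulr_ge0// powR_ge0.
have e'0 : 0 < e / c by rewrite divr_gt0.
have [K K0 HK] := prod_le_sum_powR nl e'0.
exists K => // w hs mw wM hsr.
have w0 x : 0 <= w x by have /andP[] := wM x.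
have wleM x : w x <= M by have /andP[] := wM x.
have Iw : intg w.
  apply: (@intg_le _ _ _ _ _ (cst M)) => //; first exact: intg_cst.
  by move=> x; rewrite ger0_norm.
have Is : intg (fun x => \sum_(j < n) `|hs j x| `^ l).
  apply: (@intg_sum _ _ _ _ n (fun j x => `|hs j x| `^ l)) => j.
  exact: intg_powR.
apply: (@le_trans _ _ (Ex (fun x => K * w x +
    (e / c * M) * \sum_(j < n) `|hs j x| `^ l))).
  apply: Ex_le => [||x].
  - exact: intg_weight_prod nl mw wM.
  - by apply: intgD; apply: intgZ.
  - apply: (le_trans (ler_wpM2l (w0 x) (HK (fun j => `|hs j x|) _))) => //.
    rewrite mulrDr (mulrC (w x)) lerD2l mulrCA -mulrA ler_wpM2l ?(ltW e'0)//.
    by rewrite ler_wpM2r// sumr_ge0// => j _; exact: powR_ge0.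
rewrite ExD; [|exact: intgZ..].
rewrite !ExZ// lerD2l (@Ex_sum _ _ _ _ n (fun j x => `|hs j x| `^ l)); last first.
  by move=> j; exact: intg_powR.
rewrite (@le_trans _ _ (e / c * M * (n%:R * r `^ l)))//.
  rewrite ler_wpM2l//; first by rewrite mulr_ge0// ltW.
  rewrite -[X in X%:R](card_ord n) mulr_natl -sumr_const ler_sum// => j _.
  exact: Ex_powR_le.
by rewrite -mulrA -mulrA ger_pMr// mulrC ler_pdivrMr// mul1r lerDl.
Qed.

Definition mean_prod (f : R -> R) n (b : Ls) (hs : nat -> Ls) : R :=
  Ex (fun x => f (b x) * \prod_(j < n) hs j x).

Lemma measurable_mean_prod (f : R -> R) n b hs : measurable_fun [set: R] f ->
  measurable_fun [set: T] (fun x => f (b x) * \prod_(j < n) hs j x).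
Proof.
move=> mf; apply: measurable_funM.
  by apply: measurableT_comp => //; exact: Lspace_measurable.
by apply: measurable_prod => j _; exact: Lspace_measurable.
Qed.

Lemma dpoly_measurable P : measurable_fun [set: R] (@dpoly R P).
Proof. exact: derive_measurable (@dpoly_derive _ P). Qed.

Lemma dens_measurable : measurable_fun [set: R] (@dens R).
Proof. exact: derive_measurable (@dens_derive _). Qed.

Lemma intg_dpoly_prod P n b hs : n%:R < l ->
  intg (fun x => dpoly P (b x) * \prod_(j < n) hs j x).
Proof.
move=> nl; have [M M0 HM] := dpoly_bounded P.
apply: intg_bounded_prod nl _ (fun x => HM (b x)).
by apply: measurableT_comp; [exact: dpoly_measurable|exact: Lspace_measurable].
Qed.

Lemma intg_dens b : intg (fun x => dens (b x)).
Proof.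
apply: (@intg_le _ _ _ _ _ (fun x => 1 + `|b x|)).
- by apply: measurableT_comp; [exact: dens_measurable|exact: Lspace_measurable].
- by apply: intgD; [exact: intg_cst|exact/intg_norm/Lspace_intg].
- by move=> x; rewrite gtr0_norm ?dens_gt0// dens_le.
Qed.

Lemma mean_prod_head P n b hs c u v : n.+1%:R < l ->
  mean_prod (dpoly P) n.+1 b (scons (c *: u + v) hs) =
  c * mean_prod (dpoly P) n.+1 b (scons u hs) +
  mean_prod (dpoly P) n.+1 b (scons v hs).
Proof.
move=> nl; rewrite /mean_prod -ExZ; last exact: intg_dpoly_prod.
rewrite -ExD; [|exact/intgZ/intg_dpoly_prod|exact: intg_dpoly_prod].
apply: Ex_ae_eq.
- exact: (measurable_mean_prod _ _ _ (@dpoly_measurable P)).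
- apply: measurable_funD.
    apply: measurable_funM => //.
    exact: (measurable_mean_prod _ _ _ (@dpoly_measurable P)).
  exact: (measurable_mean_prod _ _ _ (@dpoly_measurable P)).
- apply: filterS2 (LspaceD_ae (c *: u) v) (LspaceZ_ae c u) => x Hd Hz _.
  by rewrite !big_ord_recl /= (Hd I) (Hz I); ring.
Qed.

Lemma mean_prod_bounded P n : n%:R < l -> bounded_fam (mean_prod (dpoly P) n).
Proof.
move=> nl r; have [M M0 HM] := dpoly_bounded P.
have [K K0 HK] := Ex_weight_prod r nl ltr01 M0.
exists (K * M + 1) => [|b hs _ hsr]; first by rewrite addr_ge0// mulr_ge0.
have mb : measurable_fun [set: T] (fun x => `|dpoly P (b x)|).
  apply: measurableT_comp => //; apply: measurableT_comp; last exact: Lspace_measurable.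
  exact: dpoly_measurable.
rewrite (le_trans (Ex_normr_le (intg_dpoly_prod _ _ _ nl)))//.
under eq_fun do rewrite normrM normr_prod.
rewrite (le_trans (HK _ _ mb _ hsr))//; first by move=> x; rewrite normr_ge0 HM.
rewrite lerD2r ler_wpM2l// -[leRHS](Ex_cst mu); apply: Ex_le => //.
- apply: (@intg_le _ _ _ _ _ (cst M)) => //; first exact: intg_cst.
  by move=> x; rewrite normr_id.
- exact: intg_cst.
Qed.

(** The weight is the increment of [dpoly P], bounded and with mean controlled by
the distance of the base points. *)
Lemma mean_prod_unif_continuous P n : n%:R < l ->
  unif_continuous_fam (mean_prod (dpoly P) n).
Proof.
move=> nl; apply: unif_continuousC => a r.
have [M M0 HM] := dpoly_bounded P; have [L L0 HL] := dpoly_lipschitz P.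
exists 2 => // e e0.
have MM0 : 0 <= M + M by rewrite addr_ge0.
have [K K0 HK] := Ex_weight_prod r nl e0 MM0.
have d0 : 0 < e / (K * (L * 2) + 1) by rewrite divr_gt0// ltr_wpDl// !mulr_ge0.
have ad : \forall b \near a, `|a - b| < e / (K * (L * 2) + 1).
  by have := nbhsx_ballx a _ d0; rewrite -ball_normE.
apply: filterS ad => b ab hs hsr; rewrite /mean_prod.
rewrite -ExB; [|exact: intg_dpoly_prod..].
have mw : measurable_fun [set: T] (fun x => `|dpoly P (b x) - dpoly P (a x)|).
  apply: measurableT_comp => //; apply: measurable_funB;
    (apply: measurableT_comp; [exact: dpoly_measurable|exact: Lspace_measurable]).
rewrite (le_trans (Ex_normr_le _))//; first by apply: intgB; exact: intg_dpoly_prod.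
under eq_fun do rewrite -mulrBl normrM normr_prod.
rewrite (le_trans (HK _ _ mw _ hsr))//.
  by move=> x; rewrite normr_ge0 (le_trans (ler_normB _ _))// lerD.
rewrite mulr_natl mulr2n lerD2r.
have Iw : intg (fun x => `|dpoly P (b x) - dpoly P (a x)|).
  apply: (@intg_le _ _ _ _ _ (cst (M + M))) => //; first exact: intg_cst.
  by move=> x; rewrite normr_id (le_trans (ler_normB _ _))// lerD.
have IL : intg (fun x => L * `|(b - a : Ls) x|).
  exact/intgZ/intg_norm/Lspace_intg.
have Ew : Ex (fun x => `|dpoly P (b x) - dpoly P (a x)|) <= L * (2 * `|b - a|).
  apply: (@le_trans _ _ (Ex (fun x => L * `|(b - a : Ls) x|))).
    apply: Ex_ae_le => //; apply: filterS2 (LspaceD_ae b (- a)) (LspaceN_ae a).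
    move=> x Hd Hn; rewrite (Hd I) (Hn I).
    by have := HL (a x) (b x - a x); rewrite (addrC (a x)) subrK.
  rewrite ExZ; last exact/intg_norm/Lspace_intg.
  by rewrite ler_wpM2l// Ex_norm_le.
rewrite (le_trans (ler_wpM2l K0 Ew))// !mulrA -(mulrA K).
rewrite -normrN opprB; move: ab; rewrite ltr_pdivlMr ?ltr_wpDl ?mulr_ge0//.
rewrite mulrC mulrDl mul1r => /ltW; apply: le_trans.
by rewrite lerDl.
Qed.

(** The first-order remainder is a weight, at most [M] and at most [M * `|h|],
times one more factor [h], so that it falls under the previous estimate with
[n.+1] factors once [h] is normalized. *)
Lemma mean_prod_unif_derivative (f : R -> R) Q n : n.+1%:R < l ->
  (forall x : R, is_derive x 1 f (dpoly Q x)) ->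
  (forall b hs, intg (fun x => f (b x) * \prod_(j < n) hs j x)) ->
  unif_derivative (mean_prod f n) (mean_prod (dpoly Q) n.+1).
Proof.
move=> nl df If; apply: unif_derivativeC => a r.
have mf := derive_measurable df.
have [M M0 HM] := taylor1_dpoly df.
exists 2 => // e e0.
have [K K0 HK] := Ex_weight_prod (Num.max r 1) nl e0 M0.
have d0 : 0 < e / (K * (M * 2) + 1) by rewrite divr_gt0// ltr_wpDl// !mulr_ge0.
have hd : \forall h \near (0 : Ls), `|h| < e / (K * (M * 2) + 1).
  have := nbhsx_ballx (0 : Ls) _ d0; rewrite -ball_normE; apply: filterS => h /=.
  by rewrite sub0r normrN.
apply: filterS hd => h hd hs hsr.
have [->|h0] := eqVneq h 0.
  rewrite addr0 subrr sub0r head_linear0; first by rewrite oppr0 !normr0 mulr0.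
  by move=> *; exact: mean_prod_head.
have t0 : 0 < `|h| by rewrite normr_gt0.
pose w x := Num.min M (M * `|h x|).
have mh := Lspace_measurable h.
have mw : measurable_fun [set: T] w.
  apply: (measurable_minr (f := cst M) (g := fun x => M * `|h x|)) => //.
  by apply: measurable_funM => //; exact: measurableT_comp.
have wM x : 0 <= w x <= M by rewrite le_min M0 mulr_ge0//= ge_min lexx.
pose h' : Ls := `|h|^-1 *: h.
have hs'r : seq_bounded (Num.max r 1) (scons h' hs).
  apply: seq_bounded_scons; last by apply: seq_boundedW hsr; rewrite le_max lexx.
  by rewrite normrZ normfV normr_id mulVf ?gt_eqF// le_max lexx orbT.
have mx := measurable_prod_norm n.+1 (scons h' hs).
rewrite /mean_prod -ExB; [|exact: If..].
rewrite -ExB; [|by apply: intgB; exact: If|exact: intg_dpoly_prod].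
apply: (@le_trans _ _ (`|h| *
    Ex (fun x => w x * \prod_(j < n.+1) `|scons h' hs j x|))).
  rewrite -ExZ; last exact: intg_weight_prod nl mw wM.
  rewrite (le_trans (Ex_normr_le _))//.
    by apply: intgB; [by apply: intgB; exact: If|exact: intg_dpoly_prod].
  apply: Ex_ae_le.
  - by apply: intg_norm; apply: intgB; [by apply: intgB; exact: If|exact: intg_dpoly_prod].
  - by apply: intgZ; exact: intg_weight_prod nl mw wM.
  - apply: filterS2 (LspaceD_ae a h) (LspaceZ_ae `|h|^-1 h) => x Hd Hz.
    rewrite !big_ord_recl /= (Hd I) (Hz I) mulrA -!mulrBl normrM normr_prod.
    rewrite normrM normfV normr_id !mulrA ler_wpM2r ?prodr_ge0//.
    have -> : `|h| * w x * `|h|^-1 * `|h x| = w x * `|h x|.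
      by field; rewrite gt_eqF.
    exact: HM.
rewrite mulrC ler_wpM2r// (le_trans (HK _ _ mw wM hs'r))//.
rewrite mulr_natl mulr2n lerD2r.
have Iw : intg w.
  apply: (@intg_le _ _ _ _ _ (cst M)) => //; first exact: intg_cst.
  by move=> x; have /andP[w0 ?] := wM x; rewrite ger0_norm.
have Ew : Ex w <= M * (2 * `|h|).
  apply: (@le_trans _ _ (Ex (fun x => M * `|h x|))).
    apply: Ex_le => //; first exact/intgZ/intg_norm/Lspace_intg.
    by move=> x; rewrite ge_min lexx orbT.
  rewrite ExZ; last exact/intg_norm/Lspace_intg.
  by rewrite ler_wpM2l// Ex_norm_le.
rewrite (le_trans (ler_wpM2l K0 Ew))// !mulrA -(mulrA K).
move: hd; rewrite ltr_pdivlMr ?ltr_wpDl ?mulr_ge0//.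
rewrite mulrC mulrDl mul1r => /ltW; apply: le_trans.
by rewrite lerDl.
Qed.

End Lspace_estimates.

(** * Total mass as a convex function of the chart value *)

Section inclusion_in_charts.
Context d (T : measurableType d) (R : realType) (mu : probability T R).
Variables (l : R) (l1 : (1 <= l%:E)%E) (l2 : 2 <= l).
Local Notation Ls := (LspaceType mu l1).
Local Notation L0 := (Lspace0 mu l1).
Local Notation Ex := (Ex mu).
Local Notation intg := (intg mu).
Local Notation cst_ := (Lspace_cst mu l1).

Lemma Lspace_cst_ae c : (cst_ c : T -> R) = cst c %[ae mu].
Proof. exact: Lspace_ofE. Qed.

Lemma Lspace_cst_scale c : cst_ c = c *: cst_ 1.
Proof.
apply: Lspace_ae_eq.
apply: filterS3 (Lspace_cst_ae c) (Lspace_cst_ae 1) (LspaceZ_ae c (cst_ 1)).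
by move=> x Hc H1 Hz _; rewrite (Hc I) (Hz I) (H1 I) mulr1.
Qed.

Lemma Lspace_cst_add_ae (a : Ls) c :
  ((a + cst_ c : Ls) : T -> R) = (fun x => a x + c) %[ae mu].
Proof.
apply: filterS2 (LspaceD_ae a (cst_ c)) (Lspace_cst_ae c) => x Hd Hc _.
by rewrite (Hd I) (Hc I).
Qed.

Lemma Lspace0_mean (a : L0) : Ex (a : Ls) = 0.
Proof.
by have := valP a; rewrite inE unlock => /eqP; rewrite /Ex /Rintegral => ->.
Qed.

Lemma intg_sqr (a : Ls) : intg (fun x => `|a x| ^+ 2).
Proof.
apply: (@intg_le _ _ _ _ _ (fun x => 1 + `|a x| `^ l)).
- by apply: measurable_funX; apply: measurableT_comp => //; exact: Lspace_measurable.
- by apply: intgD; [exact: intg_cst|exact: intg_powR].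
- move=> x; rewrite ger0_norm ?exprn_ge0//.
  have [x1|x1] := leP `|a x| 1; first by rewrite ler_wpDr ?powR_ge0// exprn_ile1.
  by rewrite ler_wpDl// -powR_mulrn// ler_powR// ltW.
Qed.

Lemma Ex_sqr_le (a : Ls) r : `|a| <= r -> Ex (fun x => `|a x| ^+ 2) <= 1 + r `^ l.
Proof.
move=> ar; apply: (@le_trans _ _ (Ex (fun x => 1 + `|a x| `^ l))).
  apply: Ex_le => [||x]; first exact: intg_sqr.
    by apply: intgD; [exact: intg_cst|exact: intg_powR].
  have [x1|x1] := leP `|a x| 1; first by rewrite ler_wpDr ?powR_ge0// exprn_ile1.
  by rewrite ler_wpDl// -powR_mulrn// ler_powR// ltW.
rewrite ExD; [|exact: intg_cst|exact: intg_powR].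
by rewrite Ex_cst lerD2l; exact: Ex_powR_le.
Qed.

Definition mass (b : Ls) : R := Ex (fun x => dens (b x)).

Definition mass_slope (b : Ls) : R := Ex (fun x => 1 - dlogdens (b x)).

Lemma slope_measurable (b : Ls) :
  measurable_fun [set: T] (fun x => 1 - dlogdens (b x)).
Proof.
have -> : (fun x => 1 - dlogdens (b x)) = dpoly (@dens_slope R) \o b.
  by apply/funext => x /=; rewrite dpoly_dens_slope.
by apply: measurableT_comp; [exact: dpoly_measurable|exact: Lspace_measurable].
Qed.

Lemma slope_bound (x : R) : 0 <= 1 - dlogdens x <= 1.
Proof. by rewrite subr_ge0 dlogdens_le1 gerBl ltW// dlogdens_gt0. Qed.

Lemma intg_slope (b : Ls) : intg (fun x => 1 - dlogdens (b x)).
Proof.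
apply: (@intg_le _ _ _ _ _ (cst 1)); [exact: slope_measurable|exact: intg_cst|].
by move=> x; have /andP[s0 s1] := slope_bound (b x); rewrite ger0_norm.
Qed.

Lemma intg_slope_mul (b h : Ls) : intg (fun x => (1 - dlogdens (b x)) * h x).
Proof.
apply: (@intg_le _ _ _ _ _ (fun x => `|h x|)).
- by apply: measurable_funM; [exact: slope_measurable|exact: Lspace_measurable].
- exact/intg_norm/Lspace_intg.
- move=> x; have /andP[s0 s1] := slope_bound (b x).
  by rewrite normrM (ger0_norm s0) ler_piMl.
Qed.

Lemma Ex_slope_mul_le (b h : Ls) :
  `|Ex (fun x => (1 - dlogdens (b x)) * h x)| <= 2 * `|h|.
Proof.
rewrite (le_trans (Ex_normr_le (intg_slope_mul _ _)))//.
rewrite (le_trans _ (Ex_norm_le h))//; apply: Ex_le => [||x].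
- exact/intg_norm/intg_slope_mul.
- exact/intg_norm/Lspace_intg.
- have /andP[s0 s1] := slope_bound (b x).
  by rewrite normrM (ger0_norm s0) ler_piMl.
Qed.

(** Convexity of [dens], integrated. *)
Lemma mass_tangent (b h : Ls) :
  mass b + Ex (fun x => (1 - dlogdens (b x)) * h x) <= mass (b + h).
Proof.
have Ib := intg_dens b; have Is := intg_slope_mul b h.
rewrite /mass -ExD//; apply: Ex_ae_le; [exact: intgD|exact: intg_dens|].
apply: filterS (LspaceD_ae b h) => x Hd; rewrite (Hd I).
have := dens_tangent (b x) (b x + h x).
by rewrite (addrC (b x)) addrK (addrC (h x)).
Qed.

Lemma Ex_slope_cst (b : Ls) (h : Ls) c :
  Ex (fun x => (1 - dlogdens (b x)) * (h + cst_ c : Ls) x) =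
  Ex (fun x => (1 - dlogdens (b x)) * h x) + c * mass_slope b.
Proof.
rewrite /mass_slope -ExZ; last exact: intg_slope.
rewrite -ExD; [|exact: intg_slope_mul|exact/intgZ/intg_slope].
apply: Ex_ae_eq.
- by apply: measurable_funM; [exact: slope_measurable|exact: Lspace_measurable].
- apply: measurable_funD.
    by apply: measurable_funM; [exact: slope_measurable|exact: Lspace_measurable].
  by apply: measurable_funM => //; exact: slope_measurable.
- by apply: filterS (Lspace_cst_add_ae h c) => x Hd _; rewrite (Hd I); ring.
Qed.

Lemma Ex_slope0 (b : Ls) : Ex (fun x => (1 - dlogdens (b x)) * (0 : Ls) x) = 0.
Proof.
rewrite -[RHS](Ex_cst mu 0); apply: Ex_ae_eq => //.
  by apply: measurable_funM; [exact: slope_measurable|exact: Lspace_measurable].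
by apply: filterS (Lspace0_ae mu l1) => x Hd _; rewrite (Hd I) mulr0.
Qed.

(** On the level set of total mass 1, pointwise optimisation over [s] of
[1 / (1 + p) >= 2 s - s ^ 2 (1 + p)] gives what Cauchy-Schwarz would. *)
Lemma mass_slope_ge (b : Ls) (C : R) : mass b = 1 ->
  0 <= C -> intg (fun x => dens (b x) ^+ 2) ->
  Ex (fun x => dens (b x) ^+ 2) <= C -> (1 + C)^-1 <= mass_slope b.
Proof.
move=> b1 C0 I2 E2; have c0 : 0 < 1 + C by rewrite ltr_wpDr.
set s := (1 + C)^-1; have s0 : 0 < s by rewrite invr_gt0.
have Id := intg_dens b.
apply: (@le_trans _ _ (Ex (fun x => (2 * s - s ^+ 2) * dens (b x) - s ^+ 2 * dens (b x) ^+ 2))).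
  rewrite ExB; [|exact: intgZ..].
  rewrite !ExZ// [Ex (fun x => dens (b x))]b1 mulr1.
  rewrite (@le_trans _ _ (2 * s - s ^+ 2 - s ^+ 2 * C))//.
    have -> : 2 * s - s ^+ 2 - s ^+ 2 * C = 2 * s - s * (s * (1 + C)) by ring.
    by rewrite mulVf ?gt_eqF// mulr1 mulr_natl mulr2n addrK.
  by rewrite lerD2l lerN2 ler_wpM2l// sqr_ge0.
apply: Ex_le => [||x]; [by apply: intgB; exact: intgZ|exact: intg_slope|].
rewrite -dens_dlogdens /dlogdens; set p := dens (b x).
have p0 : 0 < p := dens_gt0 _.
have q0 : 0 < 1 + p by rewrite addr_gt0.
rewrite ler_pdivlMr//.
have : 0 <= p * (1 - s * (1 + p)) ^+ 2 by rewrite mulr_ge0 ?sqr_ge0 ?ltW.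
nra.
Qed.

Lemma intg_dens_sqr (b : Ls) : intg (fun x => dens (b x) ^+ 2).
Proof.
apply: (@intg_le _ _ _ _ _ (fun x => 2 + 2 * `|b x| ^+ 2)).
- apply: measurable_funX; apply: measurableT_comp; last exact: Lspace_measurable.
  exact: dens_measurable.
- by apply: intgD; [exact: intg_cst|exact/intgZ/intg_sqr].
- move=> x; rewrite ger0_norm ?sqr_ge0//.
  have p0 := dens_gt0 (b x); have p1 := dens_le (b x).
  have : 0 <= (1 - `|b x|) ^+ 2 by rewrite sqr_ge0.
  nra.
Qed.

Lemma mass_slope_gt0 (b : Ls) : mass b = 1 -> 0 < mass_slope b.
Proof.
move=> b1; set C := Ex (fun x => dens (b x) ^+ 2).
have C0 : 0 <= C by apply: Ex_ge0 => x; exact: sqr_ge0.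
apply: lt_le_trans (mass_slope_ge b1 C0 (intg_dens_sqr b) (lexx _)).
by rewrite invr_gt0 ltr_wpDr.
Qed.

Lemma dens_nondecreasing (x y : R) : x <= y -> dens x <= dens y.
Proof.
move=> xy; have /andP[s0 _] := slope_bound x.
by rewrite (le_trans _ (dens_tangent x y))// lerDl mulr_ge0// subr_ge0.
Qed.

(** Where [a <= s], a shift by [- 2 * s] leaves a density of at most [dens (- s)],
which is at most [1 / 2] for [2 <= s]; elsewhere [dens a <= 1 + `|a|] contributes
at most [C / s] to the mean, by a Markov-type bound. *)
Lemma mass_small (a : Ls) : exists2 z : R, z <= 0 & mass (a + cst_ z) <= 1.
Proof.
pose C := Ex (fun x => `|a x| + `|a x| ^+ 2).
have IC : intg (fun x => `|a x| + `|a x| ^+ 2).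
  by apply: intgD; [exact/intg_norm/Lspace_intg|exact: intg_sqr].
have C0 : 0 <= C by apply: Ex_ge0 => x; rewrite addr_ge0// exprn_ge0.
pose s := 2 * C + 2.
have s0 : 0 < s by rewrite ltr_wpDl ?mulr_ge0.
have ds : dens (- s) <= 1 / 2.
  have u1 : logdens (- s) <= -1.
    rewrite leNgt -ltr_balance logdensK /balance -leNgt.
    have := expR_gt0 (- 1 : R); rewrite /s; lra.
  rewrite (@le_trans _ _ (expR (- 1)))//; first by rewrite ler_expR.
  rewrite expRN mul1r lef_pV2 ?posrE ?expR_gt0//.
  by rewrite (le_trans _ (expR_ge1Dx 1)).
exists (- s - s); first by lra.
apply: (@le_trans _ _ (Ex (fun x => 1 / 2 + s^-1 * (`|a x| + `|a x| ^+ 2)))).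
  apply: Ex_ae_le; [exact: intg_dens|by apply: intgD; [exact: intg_cst|exact: intgZ]|].
  apply: filterS (Lspace_cst_add_ae a (- s - s)) => x Hd; rewrite (Hd I).
  have [xs|xs] := leP (a x) s.
    rewrite (@le_trans _ _ (dens (- s)))//; first by apply: dens_nondecreasing; lra.
    by rewrite ler_wpDr// mulr_ge0 ?invr_ge0 ?(ltW s0)// addr_ge0// exprn_ge0.
  have x0 : 0 < a x by exact: lt_trans xs.
  rewrite ler_wpDl// (@le_trans _ _ (dens (a x)))//.
    by apply: dens_nondecreasing; lra.
  rewrite (le_trans (dens_le _))// mulrC ler_pdivlMr// gtr0_norm//.
  by nra.
rewrite ExD; [|exact: intg_cst|exact: intgZ].
rewrite Ex_cst ExZ// -/C.
have : s^-1 * C <= 1 / 2.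
  by rewrite mulrC ler_pdivrMr// /s; lra.
lra.
Qed.

End inclusion_in_charts.

(** * The inclusion in charts *)

Section inclusion_map.
Context d (T : measurableType d) (R : realType) (mu : probability T R).
Variables (l : R) (l1 : (1 <= l%:E)%E) (l2 : 2 <= l).
Local Notation Ls := (LspaceType mu l1).
Local Notation L0 := (Lspace0 mu l1).
Local Notation Ex := (Ex mu).
Local Notation cst_ := (Lspace_cst mu l1).
Implicit Types (a b h : L0) (hs : nat -> L0).

Lemma mass0 : mass (0 : Ls) = 1.
Proof.
rewrite -[RHS](Ex_cst mu 1); apply: Ex_ae_eq => //.
  by apply: measurableT_comp; [exact: dens_measurable|exact: Lspace_measurable].
by apply: filterS (Lspace0_ae mu l1) => x Hd _; rewrite (Hd I) dens0.
Qed.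

(** The tangent of the mass at 0, where the slope of [dens] is [1 / 2]; a centred
[a] contributes nothing. *)
Lemma mass_centered_ge a z : 1 + z / 2 <= mass ((a : Ls) + cst_ z).
Proof.
have := mass_tangent 0 ((a : Ls) + cst_ z); rewrite add0r mass0; apply: le_trans.
rewrite lerD2l Ex_slope_cst.
rewrite (@Ex_ae_eq _ _ _ mu _ (fun x => (1 - dlogdens 0) * (a : Ls) x)).
- rewrite ExZ ?Lspace0_mean ?mulr0 ?add0r; last exact: Lspace_intg.
  rewrite /mass_slope (@Ex_ae_eq _ _ _ mu _ (cst (1 / 2))).
  + by rewrite Ex_cst mul1r.
  + exact: slope_measurable.
  + exact: measurable_cst.
  + apply: filterS (Lspace0_ae mu l1) => x Hd _; rewrite (Hd I) /dlogdens dens0.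
    by rewrite /=; field.
- by apply: measurable_funM; [exact: slope_measurable|exact: Lspace_measurable].
- by apply: measurable_funM => //; exact: Lspace_measurable.
- by apply: filterS (Lspace0_ae mu l1) => x Hd _; rewrite (Hd I).
Qed.

Lemma mass_cst_lipschitz (b : Ls) z w :
  `|mass (b + cst_ z) - mass (b + cst_ w)| <= `|z - w|.
Proof.
rewrite /mass -ExB; [|exact: intg_dens..].
have Ig := intgB (intg_dens (b + cst_ z)) (intg_dens (b + cst_ w)).
rewrite (le_trans (Ex_normr_le Ig))// -[leRHS](Ex_cst mu).
apply: Ex_ae_le; [exact: intg_norm|exact: intg_cst|].
apply: filterS2 (Lspace_cst_add_ae b z) (Lspace_cst_add_ae b w) => x Hz Hw.
rewrite (Hz I) (Hw I).
have [y _] := mean_value (b x + w) (z - w) (@dens_derive R).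
rewrite (_ : b x + w + (z - w) = b x + z) => [->|]; last by ring.
by have /andP[s0 s1] := slope_bound y; rewrite normrM (ger0_norm s0) ler_piMl.
Qed.

Lemma exists_log_mean a : exists z, mass ((a : Ls) + cst_ z) = 1.
Proof.
have [z z0 mz] := mass_small l2 (a : Ls).
pose F z := mass ((a : Ls) + cst_ z).
have cF : {within `[z, 0], continuous F}.
  apply: continuous_subspaceT => w; apply/cvgrPdist_le => e e0.
  have : \forall t \near w, `|w - t| < e.
    by have := nbhsx_ballx w e e0; rewrite -ball_normE.
  by apply: filterS => t /ltW wt; apply: le_trans wt; exact: mass_cst_lipschitz.
have m0 : 1 <= F 0.
  by have := mass_centered_ge a 0; rewrite mul0r addr0.
have [|c _ Fc] := IVT (v := 1) z0 cF; last by exists c.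
by rewrite ge_min le_max mz m0 orbT.
Qed.

Lemma mass_tangent_sub (b c : Ls) :
  mass b + Ex (fun x => (1 - dlogdens (b x)) * (c - b : Ls) x) <= mass c.
Proof. by have := mass_tangent b (c - b); rewrite [b + _]addrC subrK. Qed.

Lemma log_mean_sig : {z : L0 -> R | forall a, mass ((a : Ls) + cst_ (z a)) = 1}.
Proof.
exists (fun a => sval (cid (exists_log_mean a))) => a.
by case: (cid (exists_log_mean a)).
Qed.

(** For the probability density [p = dens (a + log_mean a)] this number is
[E (ln p)], as [a] is centred and [E (p - 1) = 0]. *)
Definition log_mean : L0 -> R := sval log_mean_sig.

(** Locked, lest the comparison of two of its values by computation descend into
the quotient that defines [Ls]. *)
Definition rho : L0 -> Ls := locked (fun a => (a : Ls) + cst_ (log_mean a)).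

Lemma rhoE a : rho a = (a : Ls) + cst_ (log_mean a).
Proof. by rewrite /rho; unlock. Qed.

Lemma mass_rho a : mass (rho a) = 1.
Proof. by rewrite rhoE /log_mean; case: log_mean_sig. Qed.

Lemma Lspace_cstB c e : cst_ c - cst_ e = cst_ (c - e).
Proof.
by rewrite (Lspace_cst_scale mu l1 c) (Lspace_cst_scale mu l1 e) -scalerBl
  -Lspace_cst_scale.
Qed.

Lemma rho_sub a b : rho b - rho a = ((b - a : L0) : Ls) + cst_ (log_mean b - log_mean a).
Proof. by rewrite !rhoE opprD addrACA Lspace_cstB. Qed.

(** Both points have total mass 1, so the tangent of the mass at [rho a] is
nonpositive on the increment [rho b - rho a]. *)
Lemma log_mean_sub_le a b :
  (log_mean b - log_mean a) * mass_slope (rho a) <= 2 * `|b - a|.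
Proof.
have := mass_tangent_sub (rho a) (rho b).
rewrite !mass_rho gerDl rho_sub Ex_slope_cst => H.
have := Ex_slope_mul_le (rho a) ((b - a : L0) : Ls).
rewrite ler_norml => /andP[+ _].
rewrite -[`|(b - a : L0)|]/(`|((b - a : L0) : Ls)|).
move: H; set x := Ex _; set y := (_ - _) * _; set z := 2 * _ => H1 H2.
lra.
Qed.

Lemma log_mean_unique a z : mass ((a : Ls) + cst_ z) = 1 -> z = log_mean a.
Proof.
move=> mz.
have H (b : Ls) c w : mass (b + cst_ c) = 1 -> mass (b + cst_ w) = 1 -> w <= c.
  move=> m1 m2; have := mass_tangent (b + cst_ c) (0 + cst_ (w - c)).
  rewrite Ex_slope_cst Ex_slope0 add0r m1 (_ : _ + _ + _ = b + cst_ w); last first.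
    by rewrite add0r -addrA; congr (_ + _); rewrite -Lspace_cstB addrCA subrr addr0.
  rewrite m2 gerDl pmulr_lle0 ?subr_le0//; exact: mass_slope_gt0.
by apply/eqP; rewrite eq_le; apply/andP; split; apply: (H (a : Ls)) => //;
  rewrite -rhoE mass_rho.
Qed.

Lemma log_mean_le0 a : log_mean a <= 0.
Proof.
have := mass_centered_ge a (log_mean a); rewrite -rhoE mass_rho gerDl.
by rewrite pmulr_lle0// invr_gt0.
Qed.

(** With [p <= 1 + `|a|] one has [p ^ 2 <= 2 + 2 * `|a| ^+ 2], so that for [`|a| <= r]
the bound [1 + E (p ^ 2)] is at most [rate r]. *)
Definition rate (r : R) : R := 5 + 2 * r `^ l.

Lemma rate_gt0 r : 0 < rate r.
Proof. by rewrite /rate ltr_wpDr// mulr_ge0// powR_ge0. Qed.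

Lemma mass_slope_rho_ge a r : `|a| <= r -> (rate r)^-1 <= mass_slope (rho a).
Proof.
move=> ar; rewrite /rate (_ : 5 + _ = 1 + (4 + 2 * r `^ l)); last by ring.
apply: mass_slope_ge; [exact: mass_rho| |exact: intg_dens_sqr|].
  by rewrite addr_ge0// mulr_ge0// powR_ge0.
apply: (@le_trans _ _ (Ex (fun x => 2 + 2 * `|(a : Ls) x| ^+ 2))).
  apply: Ex_ae_le; first exact: intg_dens_sqr.
    by apply: intgD; [exact: intg_cst|exact/intgZ/intg_sqr].
  apply: filterS (Lspace_cst_add_ae (a : Ls) (log_mean a)) => x Hd.
  rewrite rhoE (Hd I); set y := (a : Ls) x.
  have p0 := dens_gt0 (y + log_mean a).
  have p1 : dens (y + log_mean a) <= 1 + `|y|.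
    rewrite (le_trans _ (dens_le y))// dens_nondecreasing// gerDl.
    exact: log_mean_le0.
  have : 0 <= (1 - `|y|) ^+ 2 by rewrite sqr_ge0.
  nra.
rewrite ExD; [|exact: intg_cst|exact/intgZ/intg_sqr].
rewrite Ex_cst ExZ; last exact: intg_sqr.
have := Ex_sqr_le l2 ar; rewrite -/(Ex _); lra.
Qed.

Lemma log_mean_lipschitz r a b : `|a| <= r -> `|b| <= r ->
  `|log_mean b - log_mean a| <= 2 * rate r * `|b - a|.
Proof.
have H c e : `|c| <= r -> log_mean e - log_mean c <= 2 * rate r * `|e - c|.
  move=> cr; have [le0|gt0] := leP (log_mean e - log_mean c) 0.
    by rewrite (le_trans le0)// mulr_ge0// mulr_ge0// ltW// rate_gt0.
  rewrite mulrAC -ler_pdivrMr ?rate_gt0//.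
  rewrite (le_trans _ (log_mean_sub_le c e))//.
  by rewrite ler_wpM2l ?(ltW gt0)// mass_slope_rho_ge.
move=> ar br; rewrite ler_norml H// andbT lerNl opprB.
by rewrite (le_trans (H _ _ br))// distrC.
Qed.

Definition rho_rate r : R := 1 + 2 * rate r * `|cst_ 1|.

Lemma rho_rate_ge0 r : 0 <= rho_rate r.
Proof. by rewrite addr_ge0// mulr_ge0// mulr_ge0// ltW// rate_gt0. Qed.

Lemma rho_lipschitz r a b : `|a| <= r -> `|b| <= r ->
  `|rho b - rho a| <= rho_rate r * `|b - a|.
Proof.
move=> ar br; rewrite rho_sub (le_trans (ler_normD _ _))//.
rewrite Lspace_cst_scale normrZ mulrDl mul1r; apply: lerD => //.
by rewrite (mulrAC _ `|cst_ 1|) ler_wpM2r// log_mean_lipschitz.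
Qed.

End inclusion_map.

(** * Smoothness of the inclusion *)

Section inclusion_map_smooth.
Context d (T : measurableType d) (R : realType) (mu : probability T R).
Variables (l : R) (l1 : (1 <= l%:E)%E) (l2 : 2 <= l).
Local Notation Ls := (LspaceType mu l1).
Local Notation L0 := (Lspace0 mu l1).
Local Notation Ex := (Ex mu).
Local Notation cst_ := (Lspace_cst mu l1).
Local Notation rho := (rho l2).
Local Notation log_mean := (log_mean l2).
Implicit Types (a b h : L0) (hs : nat -> L0).

Definition val_seq hs : nat -> Ls := fun j => hs j.

Lemma val_seq_scons h hs : val_seq (scons h hs) = scons (h : Ls) (val_seq hs).
Proof. by apply/funext; case. Qed.

Definition rho_mean P n a hs : R := mean_prod (dpoly P) n (rho a) (val_seq hs).

Lemma rho_locally_lipschitz (r : R) : exists2 C : R, 0 <= C &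
  forall a b, `|a| <= r -> `|b| <= r -> `|rho b - rho a| <= C * `|b - a|.
Proof.
exists (rho_rate mu l1 r); first exact: rho_rate_ge0.
by move=> a b; exact: rho_lipschitz.
Qed.

Lemma rho_continuous : continuous (rho : L0 -> Ls).
Proof. exact: locally_lipschitz_continuous rho_locally_lipschitz. Qed.

Lemma near_rho a (P : Ls -> Prop) :
  (\forall c \near rho a, P c) -> \forall b \near a, P (rho b).
Proof. by move=> aP; exact: rho_continuous aP. Qed.

Lemma near_rho_increment a (P : Ls -> Prop) :
  (\forall u \near (0 : Ls), P u) ->
  \forall h \near (0 : L0), P (rho (a + h) - rho a).
Proof.
move=> P0; apply: (near_shift0 (P := fun b => P (rho b - rho a))).
exact: (near_rho (near_center0 (rho a) P0)).
Qed.

Lemma val_seq_bounded r hs : seq_bounded r hs -> seq_bounded r (val_seq hs).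
Proof. by []. Qed.

Lemma rho_mean_bounded P n : n%:R < l -> bounded_fam (rho_mean P n).
Proof.
move=> nl r; have [K K0 HK] := locally_lipschitz_bounded rho_locally_lipschitz r.
have [M M0 HM] := mean_prod_bounded mu l1 P nl (Num.max K r).
exists M => // a hs ar hsr; apply: HM; first by rewrite le_max (HK a hs).
by apply: seq_boundedW (val_seq_bounded hsr); rewrite le_max lexx orbT.
Qed.

Lemma rho_mean_unif_continuous P n : n%:R < l ->
  unif_continuous_fam (rho_mean P n).
Proof.
move=> nl a r e e0.
have := near_rho (mean_prod_unif_continuous P nl (rho a) r e0).
by apply: filterS => b H hs hsr; exact: H.
Qed.

Lemma rho_mean_head_linear P n : n.+1%:R < l -> head_linear (rho_mean P n.+1).
Proof.
move=> nl a hs c u v; rewrite /rho_mean !val_seq_scons; exact: mean_prod_head.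
Qed.

Lemma mean_prod_cst_head P n (b : Ls) z (ks : nat -> Ls) : n%:R < l ->
  mean_prod (dpoly P) n.+1 b (scons (cst_ z) ks) = z * mean_prod (dpoly P) n b ks.
Proof.
move=> nl; rewrite /mean_prod -ExZ; last exact: intg_dpoly_prod.
apply: Ex_ae_eq.
- exact: (measurable_mean_prod _ _ _ (@dpoly_measurable R P)).
- apply: measurable_funM => //.
  exact: (measurable_mean_prod _ _ _ (@dpoly_measurable R P)).
- apply: filterS (Lspace_cst_ae mu l1 z) => x Hz _.
  by rewrite big_ord_recl /= (Hz I) /= mulrCA.
Qed.

Lemma rho_mean_slope a hs : rho_mean (@dens_slope R) 0 a hs = mass_slope (rho a).
Proof.
rewrite /rho_mean /mean_prod /mass_slope; congr Rintegral.
by apply/funext => x; rewrite big_ord0 mulr1 dpoly_dens_slope.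
Qed.

(** The derivative of [log_mean] that implicit differentiation of
[mass (rho a) = 1] predicts. *)
Definition dlog_mean a hs : R :=
  - (rho_mean (@dens_slope R) 0 a hs)^-1 * rho_mean (@dens_slope R) 1 a hs.

Lemma exponent_gt1 : 1%:R < l.
Proof. by rewrite (lt_le_trans _ l2)// ltr1n. Qed.

Lemma dlog_mean_head_linear : head_linear dlog_mean.
Proof.
move=> a hs c u v; rewrite /dlog_mean !rho_mean_slope rho_mean_head_linear ?exponent_gt1//.
by rewrite mulrDr [c *: rho_mean _ _ _ _]/(c * _) mulrCA.
Qed.

(** The increments of [rho] split along the constants. *)
Lemma mean_prod_increment P n a h (b : Ls) (ks : nat -> Ls) : n.+1%:R < l ->
  mean_prod (dpoly P) n.+1 b (scons (rho (a + h) - rho a) ks) =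
  mean_prod (dpoly P) n.+1 b (scons (h : Ls) ks) +
  (log_mean (a + h) - log_mean a) * mean_prod (dpoly P) n b ks.
Proof.
move=> nl; have nl' : n%:R < l by rewrite (le_lt_trans _ nl)// ler_nat.
rewrite rho_sub (addrC a) addrK -[X in scons (X + _)]scale1r.
by rewrite mean_prod_head// mul1r mean_prod_cst_head.
Qed.

Lemma rho_increment_le a : exists2 C : R, 0 <= C &
  \forall h \near (0 : L0), `|rho (a + h) - rho a| <= C * `|h|.
Proof.
have [C C0 HC] := rho_locally_lipschitz (`|a| + 1); exists C => //.
apply: filterS (near_shift0 (near_norm_le a)) => h ah.
have aa : `|a| <= `|a| + 1 by rewrite lerDl.
by have := HC _ _ aa ah; rewrite (addrC a) addrK addrC.
Qed.

(** The mass is constant along [rho], so its first-order expansion at [rho a] is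
[o (h)] on the increment of [rho], which splits into [h] and a constant. *)
Lemma log_mean_unif_derivative :
  unif_derivative (fun a _ => log_mean a) dlog_mean.
Proof.
apply: unif_derivativeC => a r.
have [C C0 HC] := rho_increment_le a.
have m0 : 0 < mass_slope (rho a) by apply: mass_slope_gt0 => //; exact: mass_rho.
exists (C / mass_slope (rho a)) => [|e e0]; first by rewrite divr_ge0// ltW.
have dm : unif_derivative (mean_prod (@dens R) 0 : Ls -> _)
    (mean_prod (dpoly (@dens_slope R)) 1).
  apply: mean_prod_unif_derivative => //; first exact: exponent_gt1.
    by move=> x; rewrite dpoly_dens_slope; exact: dens_derive.
  move=> b hs; under eq_fun do rewrite big_ord0 mulr1.
  exact: intg_dens.
have massE (b : Ls) ks : mean_prod (@dens R) 0 b ks = mass b.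
  by congr Rintegral; apply/funext => x; rewrite big_ord0 mulr1.
have := near_rho_increment a (dm (rho a) r e e0).
apply: filterS2 HC => h uC + hs hsr => /(_ _ (val_seq_bounded hsr)).
rewrite !massE (addrC (rho a)) subrK !mass_rho subrr sub0r normrN.
rewrite mean_prod_increment ?exponent_gt1//.
rewrite /dlog_mean !rho_mean_slope /rho_mean val_seq_scons.
rewrite -/(rho_mean (@dens_slope R) 0 a hs) rho_mean_slope.
set u := mean_prod _ _ _ _; set z := log_mean _ - log_mean _.
set m := mass_slope _ in m0 *.
move=> H; rewrite -(ler_pM2r m0) -[X in _ * X <= _](gtr0_norm m0) -normrM.
rewrite (_ : (z - _) * m = u + z * m); last by field; rewrite gt_eqF.
rewrite (le_trans H)//.
rewrite (_ : C / m * e * `|h| * m = e * (C * `|h|)); last by field; rewrite gt_eqF.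
by rewrite ler_wpM2l// ltW.
Qed.

(** Chain rule for [rho_mean P n]: the increment of [rho] is [h] plus the constant
[dlog_mean a h], and a constant factor lowers the number of factors by one. *)
Definition rho_mean_derivative P n a hs : R :=
  rho_mean (dstep P) n.+1 a hs + dlog_mean a hs * rho_mean (dstep P) n a (hs \o S).

Lemma rho_mean_derivative_head_linear P n : n.+1%:R < l ->
  head_linear (rho_mean_derivative P n).
Proof.
move=> nl a hs c u v; rewrite /rho_mean_derivative rho_mean_head_linear//.
rewrite dlog_mean_head_linear mulrDl scalerDr addrACA.
by rewrite [c *: dlog_mean _ _]/(c * _) -mulrA.
Qed.

Lemma rho_mean_unif_derivative P n : n.+1%:R < l ->
  unif_derivative (rho_mean P n) (rho_mean_derivative P n).
Proof.
move=> nl; have nl' : n%:R < l by rewrite (le_lt_trans _ nl)// ler_nat.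
apply: unif_derivativeC => a r.
have [C C0 HC] := rho_increment_le a.
have [K K0 HK] := rho_mean_bounded (dstep P) nl' (Num.max `|a| r).
exists (C + K) => [|e e0]; first by rewrite addr_ge0.
have dm : unif_derivative (mean_prod (dpoly P) n : Ls -> _)
    (mean_prod (dpoly (dstep P)) n.+1).
  apply: mean_prod_unif_derivative => //; first exact: dpoly_derive.
  by move=> b hs; exact: intg_dpoly_prod.
have := near_rho_increment a (dm (rho a) r e e0).
have := log_mean_unif_derivative a r e0.
apply: filterS3 HC => h uC Hz + hs hsr => /(_ _ (val_seq_bounded hsr)).
have {Hz} := Hz _ hsr.
rewrite (addrC (rho a)) subrK mean_prod_increment// => Hz H.
rewrite /rho_mean_derivative {1 3}/rho_mean val_seq_scons.
have -> : scons h hs \o S = hs by [].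
rewrite [rho_mean P n a hs]/rho_mean.
rewrite -/(rho_mean (dstep P) n a hs) in H *.
set I1 := mean_prod _ n _ _ in H *; set I0 := mean_prod _ n _ _ in H *.
set D := mean_prod _ n.+1 _ _ in H *.
set I := rho_mean _ n a hs in H *; set z := log_mean _ - log_mean _ in Hz H *.
rewrite (_ : _ - _ = (I1 - I0 - (D + z * I)) + (z - dlog_mean a (scons h hs)) * I); last by ring.
rewrite (_ : (C + K) * e * `|h| = e * (C * `|h|) + e * `|h| * K); last by ring.
rewrite (le_trans (ler_normD _ _))//; apply: lerD.
  by rewrite (le_trans H)// ler_wpM2l// ltW.
rewrite normrM ler_pM// HK ?le_max ?lexx//.
by apply: seq_boundedW hsr; rewrite le_max lexx orbT.
Qed.

(** The hypothesis is the conclusion of [smooth_rho_mean] at the order [m], which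
itself needs [dlog_mean] at the order below. *)
Lemma smooth_dlog_mean m : (forall P n, (n + m)%:R < l -> smooth_fam m (rho_mean P n)) ->
  m.+1%:R < l -> smooth_fam m dlog_mean.
Proof.
move=> sm ml; have ml' : (0 + m)%:R < l by rewrite (le_lt_trans _ ml)// ler_nat.
rewrite (_ : dlog_mean = fun a hs =>
  (-1 : R) *: ((rho_mean (@dens_slope R) 0 a hs)^-1 *: rho_mean (@dens_slope R) 1 a hs)).
  apply: smooth_famZ; first exact: smooth_fam_cst.
  apply: smooth_famZ; last exact: sm.
  apply: smooth_fam_inv; first exact: sm.
  move=> r; exists (rate l r)^-1; first by rewrite invr_gt0 rate_gt0.
  move=> a hs ar _; rewrite rho_mean_slope (le_trans _ (ler_norm _))//.
  exact: mass_slope_rho_ge.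
apply/funext => a; apply/funext => hs.
by rewrite /dlog_mean scaleN1r mulNr.
Qed.

Lemma smooth_rho_mean m P n : (n + m)%:R < l -> smooth_fam m (rho_mean P n).
Proof.
elim: m P n => [|m IH] P n nl.
  by rewrite addn0 in nl; split=> //;
    [exact: rho_mean_unif_continuous|exact: rho_mean_bounded].
have nl1 : n.+1%:R < l by rewrite (le_lt_trans _ nl)// ler_nat addnS ltnS leq_addr.
have nl0 : n%:R < l by rewrite (le_lt_trans _ nl1)// ler_nat.
split; [exact: rho_mean_unif_continuous|exact: rho_mean_bounded|].
exists (rho_mean_derivative P n); split.
- exact: rho_mean_derivative_head_linear.
- exact: rho_mean_unif_derivative.
apply: smooth_famD; first by apply: IH; rewrite addSnnS.
apply: smooth_famZ.
  by apply: smooth_dlog_mean => //; rewrite (le_lt_trans _ nl)// ler_nat leq_addl.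
apply: (smooth_fam_reindex S); apply: IH; rewrite (le_lt_trans _ nl)// ler_nat.
by rewrite leq_add2l.
Qed.

Lemma smooth_log_mean m : m%:R < l -> smooth_fam m (fun a _ => log_mean a).
Proof.
have lip (r : R) : exists2 C : R, 0 <= C & forall a b, `|a| <= r -> `|b| <= r ->
    `|log_mean b - log_mean a| <= C * `|b - a|.
  exists (2 * rate l r); first by rewrite mulr_ge0// ltW// rate_gt0.
  exact: log_mean_lipschitz.
have bz := locally_lipschitz_bounded lip.
have cz := locally_lipschitz_unif_continuous lip.
case: m => [|m] ml; split=> //; exists dlog_mean; split.
- exact: dlog_mean_head_linear.
- exact: log_mean_unif_derivative.
- by apply: smooth_dlog_mean => // P n; exact: smooth_rho_mean.
Qed.

Lemma smooth_val m : smooth_fam m (fun a _ => (a : Ls)).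
Proof.
apply: (@smooth_fam_linear R L0 Ls m (fun a => a : Ls) 1) => //.
by move=> v; rewrite mul1r.
Qed.

Lemma smooth_rho m : m%:R < l -> smooth_fam m (fun a _ => rho a).
Proof.
move=> ml; rewrite (_ : (fun a _ => rho a) =
  (fun a (_ : nat -> L0) => (a : Ls) + log_mean a *: cst_ 1)).
  apply: smooth_famD; first exact: smooth_val.
  by apply: smooth_famZ; [exact: smooth_log_mean|exact: smooth_fam_cst].
by apply/funext => a; apply/funext => hs; rewrite rhoE Lspace_cst_scale.
Qed.

End inclusion_map_smooth.

(** * Measures and charts *)

Section measure_with_density.
Context d (T : measurableType d) (R : realType) (mu : probability T R).
Variable p : T -> R.
Hypotheses (p_gt0 : forall x, 0 < p x) (Ip : intg mu p).

Definition density_measure (A : set T) : \bar R :=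
  if `[< measurable A >] then (\int[mu]_(x in A) (p x)%:E)%E else 0%E.

Lemma density_measureE A : measurable A ->
  density_measure A = (\int[mu]_(x in A) (p x)%:E)%E.
Proof. by move=> mA; rewrite /density_measure asboolT. Qed.

Let density_measure0 : density_measure set0 = 0%E.
Proof. by rewrite density_measureE// integral_set0. Qed.

Let density_measure_ge0 A : (0 <= density_measure A)%E.
Proof.
rewrite /density_measure; case: ifP => // _; apply: integral_ge0 => x _.
by rewrite lee_fin ltW.
Qed.

Let density_measure_additive : semi_sigma_additive density_measure.
Proof.
move=> F mF tF mUF; rewrite density_measureE//.
under eq_fun do under eq_bigr do rewrite density_measureE//.
apply: semi_sigma_additive_nng_induced => //; first exact: measurable_int Ip.
by move=> x; rewrite lee_fin ltW.
Qed.

HB.instance Definition _ := isMeasure.Build _ _ _ density_measure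
  density_measure0 density_measure_ge0 density_measure_additive.

Let density_measure_fin : fin_num_fun density_measure.
Proof.
move=> A mA; rewrite density_measureE//; apply: integrable_fin_num => //.
exact: integrableS Ip.
Qed.

HB.instance Definition _ :=
  Measure_isFinite.Build _ _ _ density_measure density_measure_fin.

Let density_measure_off A : ~ measurable A -> density_measure A = 0%E.
Proof. by move=> mA; rewrite /density_measure asboolF. Qed.

Let P : finmeas T R := FinMeas density_measure_off.

Let mEp (A : set T) : measurable A -> measurable_fun A (EFin \o p).
Proof. by move=> mA; apply: measurable_funTS; exact: measurable_int Ip. Qed.

Let P_ac : P `<< mu.
Proof.
apply/null_content_dominatesP => A mA muA.
rewrite [LHS](density_measureE mA) -(integral_abs_eq0 mA (mEp mA) muA).
by apply: eq_integral => x _; rewrite /= gtr0_norm.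
Qed.

Let P_ca : mu `<< P.
Proof.
apply/null_content_dominatesP => A mA PA.
have : (\int[mu]_(x in A) `|(EFin \o p) x| = 0)%E.
  rewrite -PA [RHS](density_measureE mA).
  by apply: eq_integral => x _; rewrite /= gtr0_norm.
move=> /(ae_eq_integral_abs mu mA (mEp mA)) A0.
apply: measure_negligible => //; apply: negligibleS A0 => x Ax /=.
by move=> H; have := p_gt0 x; have [->] := H Ax; rewrite ltxx.
Qed.

Let P_density : density mu P = p %[ae mu].
Proof.
have Pmu : charge_of_finite_measure P `<< mu by exact: P_ac.
have H : ae_eq mu setT
    (Radon_Nikodym (charge_of_finite_measure P) mu) (EFin \o p).
  apply: integral_ae_eq => //; [exact: Radon_Nikodym_integrable|exact: mEp|].
  move=> E _ mE; rewrite -Radon_Nikodym_integral//.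
  exact: density_measureE.
by apply: filterS H => x /(_ I); rewrite /density => -> _.
Qed.

Lemma exists_finmeas : exists Q : finmeas T R,
  [/\ Q `<< mu, mu `<< Q & density mu Q = p %[ae mu]].
Proof. by exists P. Qed.

End measure_with_density.

Section charts.
Context d (T : measurableType d) (R : realType) (mu : probability T R).
Variables (l : R) (l1 : (1 <= l%:E)%E) (l2 : 2 <= l).
Local Notation Ls := (LspaceType mu l1).
Local Notation L0 := (Lspace0 mu l1).
Local Notation Ex := (Ex mu).
Local Notation intg := (intg mu).
Local Notation cst_ := (Lspace_cst mu l1).
Local Notation rho := (rho l2).
Local Notation log_mean := (log_mean l2).

Lemma mean_expectation (f : T -> R) : Ex f = fine 'E_mu[f]%E.
Proof. by rewrite unlock. Qed.

(** The set where the density is nonpositive is null for [P], hence for [mu]. *)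
Lemma density_gt0 (P : Mtilde mu l) : {ae mu, forall x, 0 < density mu P x}.
Proof.
have Pmu := Mtilde_ac P; have muP := @Mtilde_ca _ _ _ _ _ P.
have mp := measurable_density Pmu.
pose N := [set x | density mu P x <= 0].
have mN : measurable N.
  rewrite (_ : N = setT `&` density mu P @^-1` `]-oo, 0]).
    by apply: mp => //; exact: measurable_itv.
  by apply/seteqP; split=> x /=; rewrite in_itv /= => //; case.
suff muN : mu N = 0%E.
  exists N; split=> // x /= /negP; rewrite -leNgt; exact.
have /null_content_dominatesP : mu `<< P by [].
apply=> //.
have Pmu' : charge_of_finite_measure P `<< mu by exact: Pmu.
rewrite -[LHS]/(charge_of_finite_measure P N) (Radon_Nikodym_integral Pmu')//.
rewrite (@ae_eq_integral _ _ _ mu N (cst 0%E)) ?integral0//.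
  by apply: measurable_funTS; apply: (measurable_int mu); exact: Radon_Nikodym_integrable.
apply: filterS (density_ge0 Pmu) => x p0 Nx /=.
rewrite -[LHS](fineK (Radon_Nikodym_fin_num x Pmu')).
by congr EFin; apply/eqP; rewrite eq_le p0 andbT.
Qed.

Lemma chart_tilde_ae (P : Mtilde mu l) :
  (chart_tilde mu l1 P : T -> R) =
  (fun x => density mu P x - 1 + ln (density mu P x)) %[ae mu].
Proof. exact: Lspace_ofE. Qed.

Lemma dens_chart_tilde_ae (P : Mtilde mu l) :
  {ae mu, forall x, dens (chart_tilde mu l1 P x) = density mu P x}.
Proof.
apply: filterS2 (chart_tilde_ae P) (density_gt0 P) => x + p0.
by move=> /(_ I) ->; rewrite /dens logdens_ln// lnK.
Qed.

Lemma finmeas_density_ext (P Q : finmeas T R) : P `<< mu -> Q `<< mu ->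
  density mu P = density mu Q %[ae mu] -> P = Q.
Proof.
move=> Pmu Qmu PQ; apply: finmeas_ext => A mA.
have Pmu' : charge_of_finite_measure P `<< mu by exact: Pmu.
have Qmu' : charge_of_finite_measure Q `<< mu by exact: Qmu.
rewrite -[LHS]/(charge_of_finite_measure P A) -[RHS]/(charge_of_finite_measure Q A).
rewrite (Radon_Nikodym_integral Pmu')// (Radon_Nikodym_integral Qmu')//.
apply: ae_eq_integral => //.
- by apply: measurable_funTS; apply: (measurable_int mu); exact: Radon_Nikodym_integrable.
- by apply: measurable_funTS; apply: (measurable_int mu); exact: Radon_Nikodym_integrable.
- apply: filterS PQ => x /(_ I); rewrite /density => E _.
  by rewrite -(fineK (Radon_Nikodym_fin_num x Pmu')) E fineK// Radon_Nikodym_fin_num.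
Qed.

Lemma chart_tilde_inj : injective (chart_tilde mu l1).
Proof.
move=> P Q PQ.
have : (P : finmeas T R) = Q.
  apply: finmeas_density_ext; [exact: Mtilde_ac|exact: Mtilde_ac|].
  apply: filterS2 (dens_chart_tilde_ae P) (dens_chart_tilde_ae Q) => x HP HQ _.
  by rewrite -HP -HQ PQ.
case: P Q {PQ} => [P p1 p2 p3 p4] [Q q1 q2 q3 q4] /= PQ; subst Q.
by congr MkMtilde; exact: Prop_irrelevance.
Qed.

Lemma inclusion_inj : injective (inclusion mu l).
Proof.
move=> [P p] [Q q] /= PQ; subst Q; congr MkMprob; exact: Prop_irrelevance.
Qed.

Lemma mass_chart_tilde (P : Mprob mu l) : mass (chart_tilde mu l1 P) = 1.
Proof.
rewrite /mass (@Ex_ae_eq _ _ _ mu _ (density mu P)).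
- by rewrite mean_expectation Mprob_density.
- by apply: measurableT_comp; [exact: dens_measurable|exact: Lspace_measurable].
- exact/measurable_density/Mtilde_ac.
- by apply: filterS (dens_chart_tilde_ae P) => x ->.
Qed.

(** Undoing the centring adds a constant that restores total mass 1, and
[log_mean] is the only such constant. *)
Lemma rho_center (b : Ls) : mass b = 1 -> rho (Defs.center b) = b.
Proof.
move=> b1; rewrite rhoE.
have bE : b = (Defs.center b : Ls) + cst_ (fine 'E_mu[b]%E) by rewrite subrK.
by rewrite -(@log_mean_unique _ _ _ _ _ _ l2 (Defs.center b) (fine 'E_mu[b]%E)) -bE.
Qed.

Lemma rho_chart (P : Mprob mu l) : rho (chart mu l1 P) = chart_tilde mu l1 P.
Proof. by rewrite /chart rho_center// mass_chart_tilde. Qed.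

Lemma center_linear : linear (@Defs.center _ _ _ mu l l1).
Proof.
move=> c a b; apply: val_inj.
rewrite -[LHS]/((c *: a + b) - cst_ (fine 'E_mu[(c *: a + b : Ls)]%E)).
rewrite -[RHS]/(c *: (a - cst_ (fine 'E_mu[a]%E)) + (b - cst_ (fine 'E_mu[b]%E))).
rewrite expectation_lincomb fineD ?fineM ?fin_numM ?expectation_fin_num ?Lspace_Lfun1//=.
rewrite scalerBr addrACA -opprD; congr (_ - _).
rewrite [LHS]Lspace_cst_scale scalerDl -scalerA.
by rewrite -!Lspace_cst_scale.
Qed.

Lemma center_rho : cancel rho (@Defs.center _ _ _ mu l l1).
Proof.
move=> a; apply: val_inj.
rewrite -[LHS]/(rho a - cst_ (fine 'E_mu[rho a]%E)) -mean_expectation rhoE.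
rewrite (@Ex_ae_eq _ _ _ mu _ (fun x => (a : Ls) x + log_mean a)).
- rewrite ExD; [|exact: Lspace_intg|exact: intg_cst].
  by rewrite Lspace0_mean Ex_cst add0r addrK.
- exact: Lspace_measurable.
- by apply: measurable_funD => //; exact: Lspace_measurable.
- exact: Lspace_cst_add_ae.
Qed.

Lemma center_bounded : exists2 C : R, 0 <= C &
  forall b : Ls, `|Defs.center b : L0| <= C * `|b|.
Proof.
exists (1 + 2 * `|cst_ 1|) => [|b]; first by rewrite addr_ge0// mulr_ge0.
rewrite -[leLHS]/(`|b - cst_ (fine 'E_mu[b]%E)|) -mean_expectation.
rewrite Lspace_cst_scale (le_trans (ler_normB _ _))// mulrDl mul1r lerD2l.
rewrite normrZ mulrAC ler_wpM2r// (le_trans (Ex_normr_le (Lspace_intg b)))//.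
exact: Ex_norm_le.
Qed.

(** The measure with density [dens b]; the moment conditions hold since
[dens b <= 1 + `|b|] and [`|ln (dens b)| <= `|b|]. *)
Lemma chart_tilde_surj (b : Ls) : exists P : Mtilde mu l, chart_tilde mu l1 P = b.
Proof.
have [P [Pmu muP Pb]] := exists_finmeas (fun x => dens_gt0 (b x)) (intg_dens b).
have mp := measurable_density Pmu.
have pE : {ae mu, forall x, density mu P x = dens (b x)}.
  by apply: filterS Pb => x; exact.
have fin (f : R -> R) (C : R) : measurable_fun [set: R] f ->
    (forall y, 0 <= f (dens y) <= C * (1 + `|y| `^ l)) ->
    ('E_mu[fun x => f (density mu P x)] < +oo)%E.
  move=> mf fC.
  rewrite (@ae_eq_expectation _ _ _ mu _ (fun x => f (dens (b x)))).
  - rewrite unlock; apply: integrable_lty => //.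
    apply: (@intg_le _ _ _ mu _ (fun x => C * (1 + `|b x| `^ l))).
    + apply: measurableT_comp => //; apply: measurableT_comp; first exact: dens_measurable.
      exact: Lspace_measurable.
    + by apply/intgZ/intgD; [exact: intg_cst|exact: intg_powR].
    + by move=> x; have /andP[f0 f1] := fC (b x); rewrite ger0_norm.
  - exact: measurableT_comp.
  - apply: measurableT_comp => //; apply: measurableT_comp; first exact: dens_measurable.
    exact: Lspace_measurable.
  - by apply: filterS pE => x ->.
have l0 : 0 < l by exact: exponent_gt0 l1.
have mpow : measurable_fun [set: R] (fun y : R => y `^ l) by exact: measurable_powR.
have P1 : ('E_mu[fun x => (density mu P x `^ l)%R] < +oo)%E.
  apply: (fin (fun y => y `^ l) (2 `^ l)) => // y.
  rewrite powR_ge0 /=.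
  have [y1|y1] := leP `|y| 1.
    rewrite (@le_trans _ _ (2 `^ l))//; last first.
      by rewrite ler_peMr ?powR_ge0// lerDl powR_ge0.
    rewrite ge0_ler_powR ?nnegrE ?(ltW l0) ?(ltW (dens_gt0 _))//.
    by rewrite (le_trans (dens_le y))// -[2]/(1 + 1) lerD2l.
  rewrite (@le_trans _ _ ((2 * `|y|) `^ l))//.
    rewrite ge0_ler_powR ?nnegrE ?(ltW l0) ?(ltW (dens_gt0 _)) ?mulr_ge0//.
    by rewrite (le_trans (dens_le y))// mulr_natl mulr2n lerD2r ltW.
  by rewrite powRM// ler_wpM2l ?powR_ge0// lerDr.
have P2 : ('E_mu[fun x => (`|ln (density mu P x)| `^ l)%R] < +oo)%E.
  apply: (fin (fun y => `|ln y| `^ l) 1) => [|y].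
    apply: (@measurableT_comp _ _ _ _ _ _ (@powR R ^~ l)) => //.
    by apply: measurableT_comp => //; exact: measurable_ln.
  rewrite powR_ge0 mul1r ln_dens /= (@le_trans _ _ (`|y| `^ l)) ?lerDr//.
  by rewrite ge0_ler_powR ?nnegrE ?(ltW l0)// normr_logdens_le.
exists (MkMtilde Pmu muP P1 P2); apply: Lspace_ae_eq.
apply: filterS2 (chart_tilde_ae (MkMtilde Pmu muP P1 P2)) pE => x /(_ I) -> /= ->.
by rewrite ln_dens dens_balance.
Qed.

Lemma chart_surj (a : L0) : exists P : Mprob mu l, chart mu l1 P = a.
Proof.
have [P PE] := chart_tilde_surj (rho a).
have P1 : 'E_mu[density mu P]%E = 1%E.
  have Ip : intg (density mu P).
    apply: intg_ae_eq (intg_dens (rho a)); first exact/measurable_density/Mtilde_ac.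
    by apply: filterS (dens_chart_tilde_ae P) => x; rewrite PE.
  rewrite -[LHS]fineK ?unlock; last exact: integrable_fin_num.
  congr EFin; rewrite -[LHS]/(Ex (density mu P)) -(mass_rho l2 a).
  apply: Ex_ae_eq.
  - exact: intg_measurable Ip.
  - by apply: measurableT_comp; [exact: dens_measurable|exact: Lspace_measurable].
  - by apply: filterS (dens_chart_tilde_ae P) => x; rewrite PE.
by exists (MkMprob P1); rewrite /chart /= PE center_rho.
Qed.

Lemma chart_inj : injective (chart mu l1).
Proof.
move=> P Q PQ; apply/inclusion_inj/chart_tilde_inj.
by rewrite -!rho_chart PQ.
Qed.

Lemma chart_bij : bijective (chart mu l1).
Proof.
pose g a := sval (cid (chart_surj a)).
have gK : cancel g (chart mu l1) by move=> a; rewrite /g; case: cid.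
by exists g => // P; apply: chart_inj; rewrite gK.
Qed.

End charts.

(** * The embedding *)

Lemma initial_topology_embedding (V W : topologicalType) (X Y : choiceType)
    (phiX : X -> V) (phiY : Y -> W) (i : X -> Y) (f : V -> W) (c : W -> V) :
  continuous f -> continuous c -> injective i ->
  (forall x, phiY (i x) = f (phiX x)) -> (forall x, c (phiY (i x)) = phiX x) ->
  topological_embedding (i : initial_topology phiX -> initial_topology phiY).
Proof.
move=> fc cc i_inj fE cE; split=> //.
  apply: continuous_comp_initial => x.
  rewrite (_ : phiY \o i = f \o phiX); last by apply/funext => y; exact: fE.
  by apply: continuous_comp; [exact: initial_continuous|exact: fc].
move=> U [A oA UE]; exists (phiY @^-1` (c @^-1` A)).
  by exists (c @^-1` A) => //; have /continuousP cP := cc; exact: cP.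
apply/seteqP; split=> [_ [x Ux <-]|y [Acx [x _ xE]]].
  by split; [rewrite /= cE; rewrite -UE in Ux|exists x].
by exists x => //; rewrite -UE /=; rewrite -xE /= cE in Acx.
Qed.

Lemma ceil_pred_lt (R : realType) (l : R) : 2 <= l ->
  (`|Num.ceil l - 1|%N)%:R < l.
Proof.
move=> l2; rewrite natr_absz ger0_norm ?ceilB1_lt//.
by rewrite subr_ge0 -gtz0_ge1 ceil_gt0 (lt_le_trans _ l2).
Qed.

Unset Implicit Arguments.
Unset Strict Implicit.

Theorem proposition4p1 (d : measure_display) (T : measurableType d)
    (R : realType) (mu : probability T R) (lambda : R) (hlambda : 2 <= lambda) :
  let lambda1 := le1_of_le2 hlambda in
  let tphi := chart_tilde mu lambda1 in
  let phi := chart mu lambda1 in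
  let i := inclusion mu lambda in
  let n := `|Num.ceil lambda - 1|%N in
  let rho := tphi \o i \o pinv [set: Mprob mu lambda] phi in
  [/\ bijective phi,
      embedded_submanifold n phi tphi i &
      forall B : set (Lspace0 mu lambda1), bounded_set B ->
        (ereal_sup
           [set (`|rho a| + \sum_(1 <= j < n.+1) `|nderiv rho j a|)%:E
           | a in B] < +oo)%E].

Proof.
move=> lambda1 tphi phi i n rho'.
have nl : n%:R < lambda := ceil_pred_lt hlambda.
have phiB : bijective phi := chart_bij mu lambda1 hlambda.
have rhoE' a : rho' a = rho hlambda a.
  have phiK : phi (pinv [set: Mprob mu lambda] phi a) = a.
    have [g gK Kg] := phiB.
    by apply: pinvK; rewrite inE; exists (g a).
  by rewrite -[in RHS]phiK rho_chart.
have {}rhoE' : rho' = rho hlambda by exact/funext.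
pose c : {linear LspaceType mu lambda1 -> Lspace0 mu lambda1} :=
  HB.pack (@Defs.center _ _ _ mu lambda lambda1)
    (GRing.isLinear.Build R _ _ *:%R _ (@center_linear _ _ _ mu lambda lambda1)).
have cc : continuous c.
  by have [C _ HC] := center_bounded mu lambda1; exact: (@linear_le_continuous _ _ _ c C HC).
split=> //.
- split.
    apply: (@initial_topology_embedding _ _ _ _ phi tphi i (rho hlambda) c) => //.
    + exact: rho_continuous.
    + exact: inclusion_inj.
    + by move=> P; rewrite rho_chart.
  rewrite -/rho' rhoE'; apply: (left_inverse_immersion (c := c)) => //.
  + exact: smooth_fam_class_C (fun a _ => erefl) (@smooth_rho _ _ _ mu _ lambda1 hlambda _ nl).
  + move=> a; apply: smooth_fam_differentiable; apply: smooth_rho.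
    exact: exponent_gt1.
  + exact: center_rho.
- move=> B [M [_ MB]]; rewrite rhoE'.
  have sr := @smooth_rho _ _ _ mu _ lambda1 hlambda _ nl.
  have {}MB a : B a -> `|a| <= M + 1 by apply: MB; rewrite ltrDl.
  have [K HK] := smooth_fam_nderiv_sum_bounded sr (M + 1).
  apply: le_lt_trans (ltry K); apply: ge_ereal_sup => _ [a Ba <-].
  by rewrite lee_fin HK// MB.
Qed.
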